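(* Let $n\ge 1$ and let $\lambda,\mu$ be partitions of $n$. Let $ABC(\lambda,\mu)$ denote the set of affine Bruhat counter-tableaux (with $k=n$) of $n$-weight $\mu$ and inner shape $\mathfrak{c}(\lambda)$, and let $SSYT(\lambda,\mu)$ denote the set of semistandard tableaux of shape $\lambda$ and weight $\mu$. Then there is a bijection $ABC(\lambda,\mu)\to SSYT(\lambda,\mu)$ which is charge preserving, i.e. $ch(A)=ch(T)$ whenever $A\mapsto T$.
   Context: Partitions are drawn as Ferrers diagrams in French convention: $\lambda=(\lambda_1\ge\lambda_2\ge\cdots)$ has $\lambda_i$ left-justified cells in its $i$-th row counted from the bottom. The hook length of a cell is $1$ plus the number of cells to its right in its row plus the number of cells above it in its column. Fix an integer $k>0$ (in the claim, $k=n$). A $(k+1)$-core is a partition having no cell of hook length $k+1$; $\deg(\kappa)$ is the number of cells of $\kappa$ of hook length $\le k$. $\mathcal P^k$ is the set of partitions with $\lambda_1\le k$. For a $(k+1)$-core $\kappa$, the sequence whose $i$-th term is the number of cells in row $i$ of $\kappa$ with hook length $\le k$ is a partition in $\mathcal P^k$; this is a bijection from $(k+1)$-cores to $\mathcal P^k$, and $\mathfrak c:\mathcal P^k\to\{(k+1)\text{-cores}\}$ denotes its inverse. Strong order on cores: $\rho\lessdot_B\gamma$ iff $\rho\subseteq\gamma$ and $\deg(\gamma)=\deg(\rho)+1$. For a core $\lambda$, $(k+\lambda_1,\lambda)$ denotes the partition with first part $k+\lambda_1$ followed by the parts of $\lambda$. Bottom strong strip: for cores $\nu\subseteq(k+\lambda_1,\lambda)$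 and an integer $0\le m\le k-1$, the skew shape $(k+\lambda_1,\lambda)/\nu$ is a bottom strong strip of length $m$ if there is a saturated chain of cores $\nu=\nu^0\lessdot_B\nu^1\lessdot_B\cdots\lessdot_B\nu^m=(k+\lambda_1,\lambda)$ such that $(k+\lambda_1,\lambda)/\nu$ is a horizontal strip (no two cells in one column) and, for each $1\le j\le m$, the rightmost cell of the bottom (first) row of $\nu^j$ lies in $\nu^j/\nu^{j-1}$. Such a chain is unique. Affine Bruhat counter-tableau (ABC): let $\alpha=(\alpha_1,\dots,\alpha_\ell)$ with $1\le\alpha_i\le k$. An ABC $A$ of $k$-weight $\alpha$ is determined by $(k+1)$-cores $\emptyset=\lambda^{(0)},\lambda^{(1)},\dots,\lambda^{(\ell)}$ such that for each $i$, $(k+\lambda^{(i-1)}_1,\lambda^{(i-1)})/\lambda^{(i)}$ is a bottom strong strip of length $k-\alpha_i$. $A$ is a diagram with $\ell$ left-justified rows numbered $1,\dots,\ell$ from top to bottom (columns numbered $1,2,\dots$ from the left), where for each $i$ rows $1,\dots,i$, viewed with row $i$ as the bottom row, form the Ferrers diagram of $(k+\lambda^{(i-1)}_1,\lambda^{(i-1)})$; the cells of $(k+\lambda^{(i-1)}_1,\lambda^{(i-1)})/\lambda^{(i)}$ are filled with the letter $i$, and the cells of $\lambda^{(\ell)}$ are empty. The inner shape of $A$ is $\lambda^{(\ell)}$. The cells filled with $i$ are partitioned into ribbons (here runs of consecutive cells in one row), namely the connected components of the $\nu^j/\nu^{j-1}$ from the chain for the $i$-th strip; these are called $i$-ribbons.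 The head of a ribbon is its rightmost cell and its tail its leftmost cell. $A$ has partition $k$-weight $\mu$ if $\alpha=\mu$ is a partition. Extension: for an ABC $A$ of partition $k$-weight $\mu$, let $s_i$ be the total size and $r_i$ the number of $i$-ribbons in row $i$ of $A$. $ext(A)$ is obtained by appending $k$ cells containing $i$ at the right end of each row $i$, where the first $\mu_i-s_i+r_i+1$ appended cells form one $i$-ribbon and each remaining appended cell is an $i$-ribbon of size one. Let $V_A$ be the set of cells $(i,c)$ (row $i$, column $c$) of $ext(A)$ lying in an $i$-ribbon of row $i$ and not equal to that ribbon's tail. Sets $E_A^r$, $r=1,\dots,\mu_1$, constructed successively: $E_A^r$ contains the cell $(1,k+\mu_1+2-r)$; for $i\ge2$, $(i,c_i)\in E_A^r$ iff $E_A^r$ contains a cell $(i-1,c_{i-1})$ and $(i,c_i)\in V_A\setminus\bigcup_{p<r}E_A^p$ with $(c_{i-1}-c_i+k)\bmod (k+1)=\min\{(c_{i-1}-x+k)\bmod(k+1): (i,x)\in V_A\setminus\bigcup_{p<r}E_A^p\}$. Reading words: given cells $(1,c_1),\dots,(m,c_m)$ (one per row $1,\dots,m$), build a permutation of $\{1,\dots,m\}$ starting from the word $1$ and, for $i=2,\dots,m$, inserting $i$ immediately to the right of the letter $j$, where $j<i$ is chosen among indices with $c_j<c_i$ so that $c_j$ is maximal (ties broken by the largest $j$); if no $j<i$ has $c_j<c_i$, insert $i$ at the beginning. $w_r(A)$ is the permutation so obtained from $E_A^r$. Charge: for a permutation $w$ of $\{1,\dots,n\}$, $ch(w)=\sum_{i=1}^n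 c_i$ with $c_1=0$ and $c_i=c_{i-1}+1$ if $i$ appears to the right of $i-1$ in $w$, $c_i=c_{i-1}$ otherwise. For a word $w$ whose content is a partition: the first charge subword is found by scanning from the right end of $w$ leftward, marking the first $1$, then continuing leftward (cyclically wrapping from the beginning to the end) marking the first $2$, and so on up to the largest letter; the marked letters in their order in $w$ form a permutation; remove them and repeat to get the subsequent charge subwords. $ch(w)$ is the sum of the charges of its charge subwords. A semistandard tableau is a filling of a Ferrers shape with positive integers weakly increasing along rows (left to right) and strictly increasing up columns; its weight has $i$-th entry the number of $i$'s; its reading word is the concatenation of its rows from the top row to the bottom row, each read left to right, and $ch(T)$ is the charge of its reading word. For an ABC $A$ of partition $k$-weight $\mu$, $ch(A)=\sum_{r=1}^{\mu_1}ch(w_r(A))$. *)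

(* Defs.v *)
From mathcomp Require Import all_boot all_order all_algebra.
From Stdlib Require Import ClassicalEpsilon.

Set Implicit Arguments.
Unset Strict Implicit.
Unset Printing Implicit Defensive.

(* A partition is a seq nat (l_1 >= l_2 >= ... > 0); row i (0-based) is the
   i-th row counted from the bottom.  A cell is (i, j), 0-based row and
   column; (i, j) is a cell of l iff j < l_i. *)

Definition is_partition (l : seq nat) : bool :=
  sorted geq l && all (fun x => 0 < x) l.

Definition partition_of (n : nat) (l : seq nat) : bool :=
  is_partition l && (sumn l == n).

Definition part (l : seq nat) (i : nat) : nat := nth 0 l i.

Definition cells (l : seq nat) : seq (nat * nat) :=
  [seq (i, j) | i <- iota 0 (size l), j <- iota 0 (part l i)].

Definition conj_part (l : seq nat) (j : nat) : nat := count (fun x => j < x) l.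

Definition hook (l : seq nat) (i j : nat) : nat :=
  1 + (part l i - j.+1) + (conj_part l j - i.+1).

Definition is_core (k : nat) (l : seq nat) : bool :=
  is_partition l && all (fun c => hook l c.1 c.2 != k.+1) (cells l).

Definition deg (k : nat) (l : seq nat) : nat :=
  count (fun c => hook l c.1 c.2 <= k) (cells l).

(* the map (k+1)-cores -> P^k : row i |-> number of cells of hook <= k
   (trailing zero rows discarded); c(lambda) is the core sent to lambda *)
Definition kshape (k : nat) (l : seq nat) : seq nat :=
  filter (fun x => 0 < x)
    [seq count (fun j => hook l i j <= k) (iota 0 (part l i)) | i <- iota 0 (size l)].

Definition subdiag (r g : seq nat) : bool :=
  all (fun i => part r i <= part g i) (iota 0 (size r)).

Definition strong_cover (k : nat) (r g : seq nat) : bool :=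
  [&& is_core k r, is_core k g, subdiag r g & deg k g == (deg k r).+1].

Definition bump (k : nat) (l : seq nat) : seq nat := (k + part l 0) :: l.

Definition hstrip (g nu : seq nat) : bool :=
  subdiag nu g &&
  all (fun j => count (fun i => (part nu i <= j) && (j < part g i))
                      (iota 0 (size g)) <= 1)
      (iota 0 (part g 0)).

(* ch = [nu^0; ...; nu^m] witnesses that g/nu is a bottom strong strip of
   length m.  The rightmost cell (0, nu^j_1 - 1) of the bottom row of nu^j
   lies in nu^j/nu^(j-1) iff nu^(j-1)_1 < nu^j_1 (given containment). *)
Definition bstrip_chain (k : nat) (nu g : seq nat) (m : nat)
    (ch : seq (seq nat)) : Prop :=
  [/\ size ch = m.+1, nth [::] ch 0 = nu, nth [::] ch m = g,
      hstrip g nu &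
      forall j, 0 < j <= m ->
        strong_cover k (nth [::] ch j.-1) (nth [::] ch j) /\
        part (nth [::] ch j.-1) 0 < part (nth [::] ch j) 0].

Definition bottom_strong_strip (k : nat) (nu g : seq nat) (m : nat) : Prop :=
  [/\ is_core k nu, is_core k g, m <= k.-1 &
      exists ch, bstrip_chain k nu g m ch].

(* the (unique, by the paper) chain of a bottom strong strip *)
Definition the_chain (k : nat) (nu g : seq nat) (m : nat) : seq (seq nat) :=
  epsilon (inhabits [::]) (bstrip_chain k nu g m).

(* An ABC of k-weight alpha is given by its cores
   lam = [lambda^(0); ...; lambda^(l)], l = size alpha. *)
Definition is_ABC (k : nat) (alpha : seq nat) (lam : seq (seq nat)) : Prop :=
  [/\ all (fun a => 0 < a <= k) alpha,
      size lam = (size alpha).+1,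
      nth [::] lam 0 = [::],
      (forall i, i < size lam -> is_core k (nth [::] lam i)) &
      (forall i, 0 < i <= size alpha ->
         bottom_strong_strip k (nth [::] lam i) (bump k (nth [::] lam i.-1))
                             (k - nth 0 alpha i.-1))].

Definition inner_shape (lam : seq (seq nat)) : seq nat := last [::] lam.

Section ABCCharge.
Variables (k : nat) (mu : seq nat) (lam : seq (seq nat)).

(* rows of A are numbered 1..size mu from top to bottom; row i of A is the
   bottom row of (k + lambda^(i-1)_1, lambda^(i-1)); columns are 1-based. *)
Definition row_gamma (i : nat) : seq nat := bump k (nth [::] lam i.-1).
Definition row_nu (i : nat) : seq nat := nth [::] lam i.
Definition row_m (i : nat) : nat := k - nth 0 mu i.-1.
Definition row_chain (i : nat) : seq (seq nat) :=
  the_chain k (row_nu i) (row_gamma i) (row_m i).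
Definition brk (i j : nat) : nat := part (nth [::] (row_chain i) j) 0.

(* the i-ribbon of row i coming from nu^j / nu^(j-1) occupies (1-based)
   columns brk (j-1) + 1 .. brk j *)
Definition ribbon_sizes (i : nat) : seq nat :=
  [seq brk i j - brk i j.-1 | j <- iota 1 (row_m i)].
Definition s_row (i : nat) : nat := sumn (ribbon_sizes i).
Definition r_row (i : nat) : nat := count (fun x => 0 < x) (ribbon_sizes i).
Definition len_row (i : nat) : nat := part (row_gamma i) 0.
(* size of the first appended ribbon of ext(A) *)
Definition ext_len (i : nat) : nat :=
  minn (nth 0 mu i.-1 + r_row i + 1 - s_row i) k.

(* columns c with (i,c) in V_A : non-tail cells of i-ribbons of row i *)
Definition Vrow (i : nat) : seq nat :=
  flatten [seq iota (brk i j.-1).+2 (brk i j - brk i j.-1).-1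
          | j <- iota 1 (row_m i)]
  ++ iota (len_row i).+2 (ext_len i).-1.

Definition modv (c x : nat) : nat :=
  absz (((c%:Z - x%:Z + k%:Z)%R %% (k.+1)%:Z)%Z).

Definition minl (s : seq nat) : nat := foldr minn (head 0 s) s.

(* given the columns of E^1..E^(mu_1) in row i-1, compute them in row i;
   used = columns of row i already taken by E^p, p < r *)
Fixpoint build_row (V : seq nat) (prev : seq (seq nat)) (used : seq nat)
  : seq (seq nat) :=
  match prev with
  | [::] => [::]
  | pr :: rest =>
      let avail := [seq x <- V | x \notin used] in
      let e := [seq x <- avail |
                 has (fun c => modv c x == minl [seq modv c y | y <- avail]) pr] in
      e :: build_row V rest (used ++ e)
  end.

Definition mu1 : nat := nth 0 mu 0.

(* Erow i = [E^1 row i; ...; E^(mu_1) row i] (columns) *)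
Fixpoint Erow (i : nat) : seq (seq nat) :=
  match i with
  | 0 => [::]
  | i'.+1 =>
      if i' is 0 then [seq [:: k + mu1 + 2 - r] | r <- iota 1 mu1]
      else build_row (Vrow i'.+1) (Erow i') [::]
  end.

Definition Ecols (r : nat) : seq nat :=
  let rows := iota 1 (size mu) in
  let m := find (fun i => nth [::] (Erow i) r.-1 == [::]) rows in
  [seq head 0 (nth [::] (Erow i) r.-1) | i <- take m rows].

End ABCCharge.

Definition insert_after (w : seq nat) (j i : nat) : seq nat :=
  let p := index j w in take p.+1 w ++ i :: drop p.+1 w.

Definition reading_perm (cs : seq nat) : seq nat :=
  if cs is [::] then [::] else
  foldl (fun w i =>
           let ci := nth 0 cs i.-1 in
           let cands := [seq j <- iota 1 i.-1 | nth 0 cs j.-1 < ci] in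
           if cands is [::] then i :: w else
           let bestc := foldr maxn 0 [seq nth 0 cs j.-1 | j <- cands] in
           let jb := last 0 [seq j <- cands | nth 0 cs j.-1 == bestc] in
           insert_after w jb i)
        [:: 1] (iota 2 (size cs).-1).

(* charge of a permutation w of {1..n}: c_1 = 0, c_i = c_(i-1) + [i right of i-1] *)
Definition perm_charge (w : seq nat) : nat :=
  sumn [seq sumn [seq nat_of_bool (index t.-1 w < index t w) | t <- iota 2 i.-1]
       | i <- iota 1 (size w)].

Definition ABC_charge (k : nat) (mu : seq nat) (lam : seq (seq nat)) : nat :=
  sumn [seq perm_charge (reading_perm (Ecols k mu lam r)) | r <- iota 1 (mu1 mu)].

(* positions scanned leftward cyclically, starting just left of position p *)
Definition cyc_order (n p : nat) : seq nat :=
  rev (take p (iota 0 n)) ++ rev (drop p (iota 0 n)).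

Fixpoint mark_from (w : seq nat) (letters : seq nat) (p : nat) : seq nat :=
  match letters with
  | [::] => [::]
  | a :: ls =>
      let q := nth 0 [seq x <- cyc_order (size w) p | nth 0 w x == a] 0 in
      q :: mark_from w ls q
  end.

Definition first_marks (w : seq nat) : seq nat :=
  mark_from w (iota 1 (foldr maxn 0 w)) (size w).

Fixpoint word_charge_fuel (fuel : nat) (w : seq nat) : nat :=
  match fuel with
  | 0 => 0
  | f.+1 =>
      if w is [::] then 0 else
      let P := first_marks w in
      let sub := [seq nth 0 w q | q <- iota 0 (size w) & q \in P] in
      let rest := [seq nth 0 w q | q <- iota 0 (size w) & q \notin P] in
      perm_charge sub + word_charge_fuel f rest
  end.

Definition word_charge (w : seq nat) : nat := word_charge_fuel (size w) w.

(* T = [row_1; row_2; ...], row_1 the bottom row *)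
Definition is_SSYT (lam mu : seq nat) (T : seq (seq nat)) : Prop :=
  [/\ size T = size lam,
      (forall i, i < size lam -> size (nth [::] T i) = part lam i),
      all (fun row => all (fun x => 0 < x) row && sorted leq row) T,
      (forall i j, j < size (nth [::] T i.+1) ->
         nth 0 (nth [::] T i) j < nth 0 (nth [::] T i.+1) j) &
      (forall a, count_mem a.+1 (flatten T) = nth 0 mu a)].

Definition tableau_word (T : seq (seq nat)) : seq nat := flatten (rev T).

Definition tableau_charge (T : seq (seq nat)) : nat := word_charge (tableau_word T).

(* ABC(lambda, mu) with k = n: n-weight mu, inner shape c(lambda), i.e. the
   (n+1)-core whose image under kshape n is lambda *)
Definition ABC_set (n : nat) (lam mu : seq nat) (A : seq (seq nat)) : Prop :=
  [/\ is_ABC n mu A, is_core n (inner_shape A) & kshape n (inner_shape A) = lam].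

(* Main.v *)
Require Import Defs.
From mathcomp Require Import all_boot all_order all_algebra.
From mathcomp Require Import zify.
From Stdlib Require Import ClassicalEpsilon.

Set Implicit Arguments.
Unset Strict Implicit.
Unset Printing Implicit Defensive.

(** A core of degree at most k = n has only small hooks, so every core of an
    ABC is an honest partition, and each bottom strong strip amounts to a
    horizontal strip between consecutive partitions; this is the usual
    encoding of a semistandard tableau T.  The chain of a strip is forced: a
    core (a, s) with s small satisfies a = d + s_(k-d) for a unique d, and a
    cover which lengthens the first row either raises d or adds a cell to the
    row k-d of s.  Reading off the ribbons, the column of a cell of V_A is
    k + 2 plus the content of the corresponding cell of T.  The sets E^r hence
    scan the letters of T cyclically by content, while charge subwords scan
    them by reading order.  The two orders differ only on cells lying in the
    row just above the scanned one and further to the right; these have been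
    used up by earlier subwords because each row is consumed from right to
    left, so both procedures select the same cells. *)

(** * Cores with one long row *)

(** The assumption [k = n] enters through degrees. Bumping a small partition adds exactly [k] to its
    degree and the [i]-th strip then descends [k - mu_i] covers, so the [i]-th core has degree
    [mu_1 + ... + mu_i <= n]. The shift [k + 2] comes from the steps which raise [d]. When [d]
    passes from [k - s] to [k - s + 1], the end of the first row moves from [k - s + l_s] to
    [k - s + 1 + nu_s], so the non-tail cells of that ribbon correspond to the cells of [nu / l] in
    row [s]. Row [0] would require [d] to exceed [k]; its cells come from the ribbon appended in the
    extension. A cell of letter [a + 1] on which the two orders disagree lies right above a cell of
    letter [a], itself in the row of the scanning cell and further right. This injection is what
    makes the number of cells used up earlier large enough. On the charge side, only the relative
    order of consecutive letters counts, so all that is needed of a reading word is that [t] stands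
    right of [t - 1] exactly when its column is larger. *)

Lemma part_cons0 a l : part (a :: l) 0 = a. Proof. by []. Qed.

Lemma is_partition_cons a l :
  is_partition (a :: l) = [&& 0 < a, part l 0 <= a & is_partition l].
Proof.
rewrite /is_partition /= /part.
by case: l => [|b l] /=; [rewrite andbT | case: (0 < a); case: (b <= a) => //=; rewrite ?andbF].
Qed.

Lemma is_partition_behead l : is_partition l -> is_partition (behead l).
Proof. by case: l => // a l; rewrite is_partition_cons => /and3P[]. Qed.

Lemma part_behead l i : part (behead l) i = part l i.+1.
Proof. by case: l => // ; rewrite /part /= nth_nil. Qed.

Lemma part_leS l i : is_partition l -> part l i.+1 <= part l i.
Proof.
elim: l i => [|a l IH] [|i]; rewrite /part ?nth_nil //= is_partition_cons.
  by case/and3P.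
by case/and3P=> _ _ /IH.
Qed.

Lemma part_le l i j : is_partition l -> i <= j -> part l j <= part l i.
Proof.
move=> Pl; elim: j => [|j IH]; first by rewrite leqn0 => /eqP->.
rewrite leq_eqVlt => /orP[/eqP-> //|]; rewrite ltnS => /IH.
exact: leq_trans (part_leS _ Pl).
Qed.

Lemma part_gt0 l i : is_partition l -> (0 < part l i) = (i < size l).
Proof.
case/andP=> _ /allP Pl; case: (ltnP i (size l)) => li; first exact: (Pl _ (mem_nth 0 li)).
by rewrite /part nth_default.
Qed.

Lemma part_eq l l' : is_partition l -> is_partition l' -> part l =1 part l' -> l = l'.
Proof.
move=> Pl Pl' E.
suff S : size l = size l' by apply: (eq_from_nth S) => i _; apply: E.
have H i : (i < size l) = (i < size l') by rewrite -!part_gt0 // E.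
by have := H (size l); have := H (size l'); lia.
Qed.

Lemma subdiagP r g : reflect (forall i, part r i <= part g i) (subdiag r g).
Proof.
apply: (iffP allP) => H i; last by move=> _; apply: H.
case: (ltnP i (size r)) => ir; first by apply: H; rewrite mem_iota.
by rewrite /part nth_default.
Qed.

Lemma sumn_part l N : size l <= N -> sumn l = \sum_(i < N) part l i.
Proof.
elim: l N => [|a l IH] [|N] //= lN.
- by rewrite big_ord0.
- by rewrite big1 // => i _; rewrite /part nth_nil.
by rewrite big_ord_recl /= (IH N).
Qed.

Lemma sumn_sub l l' : (forall i, part l i <= part l' i) -> sumn l <= sumn l'.
Proof.
move=> H; rewrite !(@sumn_part _ (maxn (size l) (size l'))) ?leq_maxl ?leq_maxr //.
by apply: leq_sum => i _; apply: H.
Qed.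

(** The remaining rows can only grow. A cover leaves little room for the total growth, so this bound
    excludes growth in two rows at once. *)
Lemma sumn_sub2 l l' i j : (forall i, part l i <= part l' i) -> i != j ->
  sumn l + (part l' i - part l i) + (part l' j - part l j) <= sumn l'.
Proof.
move=> H ij; set N := maxn (maxn (size l) (size l')) (maxn i j).+1.
have iN : i < N by rewrite /N; lia.
have jN : j < N by rewrite /N; lia.
rewrite !(@sumn_part _ N); try by rewrite /N; lia.
rewrite (bigD1 (Ordinal iN)) //= (bigD1 (Ordinal jN)) /=; last first.
  by rewrite -val_eqE /= eq_sym.
rewrite [X in _ <= X](bigD1 (Ordinal iN)) //= [X in _ <= _ + X](bigD1 (Ordinal jN)) /=; last first.
  by rewrite -val_eqE /= eq_sym.
set S1 := \sum_(_ < _ | _) _; set S2 := \sum_(_ < _ | _) part l' _.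
have : S1 <= S2 by apply: leq_sum => t _; apply: H.
by have := H i; have := H j; lia.
Qed.

Lemma sumn_sub1 l l' i : (forall i, part l i <= part l' i) ->
  sumn l + (part l' i - part l i) <= sumn l'.
Proof. by move=> H; have := @sumn_sub2 l l' i i.+1 H; rewrite neq_ltn ltnSn => /(_ isT); lia. Qed.

Lemma sumn_sub_eq l l' : (forall i, part l i <= part l' i) -> sumn l' <= sumn l ->
  part l =1 part l'.
Proof. by move=> H S i; have := sumn_sub1 i H; have := H i; lia. Qed.

Lemma size_le_sumn l : is_partition l -> size l <= sumn l.
Proof.
elim: l => // a l IH; rewrite is_partition_cons /= => /and3P[a0 _ /IH].
lia.
Qed.

(** Each of the rows [1] to [i] has at least one cell. With [sumn l <= k] this keeps row indices and
    contents within the range of the modulus [k + 1]. *)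
Lemma part_hook_le l i : is_partition l -> 0 < part l i -> part l 0 + i <= sumn l.
Proof.
case: l => [|a l]; first by rewrite /part nth_nil.
move=> Pl; rewrite part_gt0 //=; move: Pl; rewrite is_partition_cons => /and3P[a0 _ Pl] il.
by have := size_le_sumn Pl; lia.
Qed.

Lemma part_index_lt_sumn l i : is_partition l -> 0 < part l i -> i < sumn l.
Proof.
move=> Pl H; have := part_hook_le Pl H; have := @part_le l 0 i Pl (leq0n _); lia.
Qed.

Lemma conj_part_gt l i j : is_partition l -> (i < conj_part l j) = (j < part l i).
Proof.
rewrite /conj_part; elim: l i => [|a l IH] i; first by rewrite /part nth_nil.
rewrite is_partition_cons => /and3P[a0 al Pl] /=.
have l0 t := part_le Pl (leq0n t).
case: i => [|i]; rewrite /= -?/(part l i); case: (ltnP j a) => ja; rewrite ?add1n ?add0n ?ltnS ?IH //.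
  by have := l0 0; lia.
by move: al (l0 i) (l0 i.+1); rewrite /part /=; lia.
Qed.

Lemma mem_cells l i j : ((i, j) \in cells l) = (j < part l i).
Proof.
apply/allpairsPdep/idP => [[x [y [xl yl [-> ->]]]]|jl].
  by move: yl; rewrite mem_iota.
exists i, j; split=> //; rewrite mem_iota //= add0n.
by rewrite ltnNge; apply: contraTN jl => H; rewrite /part nth_default.
Qed.

Lemma hook_cons_S a l i j : j < a -> hook (a :: l) i.+1 j = hook l i j.
Proof. by rewrite /hook /conj_part /= => ->; rewrite add1n subSS. Qed.

Lemma hook_cons_0 a l j : j < a -> hook (a :: l) 0 j = a - j + conj_part l j.
Proof. by rewrite /hook /conj_part /= => ja; rewrite ja ?part_cons0; lia. Qed.

Lemma hook_le_sumn l i j : is_partition l -> j < part l i -> hook l i j <= sumn l.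
Proof.
elim: l i => [|a l IH] i; first by rewrite /part nth_nil.
move=> Pal; have := @part_le _ 0 i Pal (leq0n i).
move: Pal; rewrite is_partition_cons => /and3P[a0 al Pl]; rewrite ?part_cons0.
case: i => [|i] ia ja.
  rewrite hook_cons_0 //=; have := count_size (fun x => j < x) l.
  by have := size_le_sumn Pl; rewrite /conj_part; lia.
rewrite hook_cons_S; last by apply: leq_trans ja ia.
by apply: leq_trans (IH i Pl ja) _; rewrite /= leq_addl.
Qed.

Lemma small_core k l : is_partition l -> sumn l <= k -> is_core k l.
Proof.
move=> Pl lk; rewrite /is_core Pl /=; apply/allP => [[i j]]; rewrite mem_cells /= => H.
by have := hook_le_sumn Pl H; rewrite neq_ltn; lia.
Qed.

Lemma deg_rows k l :
  deg k l = sumn [seq count (fun j => hook l i j <= k) (iota 0 (part l i)) | i <- iota 0 (size l)].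
Proof.
rewrite /deg /cells count_flatten -map_comp; congr sumn; apply: eq_map => i /=.
by rewrite count_map.
Qed.

Lemma count_hook_small k l i : is_partition l -> sumn l <= k ->
  count (fun j => hook l i j <= k) (iota 0 (part l i)) = part l i.
Proof.
move=> Pl lk; rewrite (@eq_in_count _ _ predT); first by rewrite count_predT size_iota.
move=> j; rewrite mem_iota /= add0n => jl.
by rewrite (leq_trans (hook_le_sumn Pl jl)).
Qed.

Lemma kshape_small k l : is_partition l -> sumn l <= k -> kshape k l = l.
Proof.
move=> Pl lk; rewrite /kshape.
have -> : [seq count (fun j => hook l i j <= k) (iota 0 (part l i)) | i <- iota 0 (size l)] = l.
  rewrite -[RHS](mkseq_nth 0); apply: eq_map => i; exact: count_hook_small.
by apply/all_filterP; case/andP: Pl.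
Qed.

Lemma deg_small k l : is_partition l -> sumn l <= k -> deg k l = sumn l.
Proof.
move=> Pl lk; rewrite deg_rows; congr sumn.
rewrite -[RHS](mkseq_nth 0); apply: eq_map => i; exact: count_hook_small.
Qed.

Lemma deg_cons k a l : is_partition (a :: l) ->
  deg k (a :: l) = count (fun j => hook (a :: l) 0 j <= k) (iota 0 a) + deg k l.
Proof.
move=> Pal; rewrite !deg_rows /= ?part_cons0; congr addn.
rewrite -[1]/(1 + 0) iotaDl -map_comp; congr sumn; apply: eq_map => i /=.
rewrite add1n {2}/part /= -/(part l i); apply: eq_in_count => j; rewrite mem_iota /= add0n => jl.
by rewrite hook_cons_S //; apply: leq_trans jl (@part_le _ 0 i.+1 Pal (leq0n _)).
Qed.

Lemma count_iota_geq p a : count (leq p) (iota 0 a) = a - p.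
Proof.
elim: a => // a IH; rewrite -addn1 iotaD count_cat IH /= add0n addn0.
by case: (leqP p a) => /= ?; lia.
Qed.

(* The first row [a] over a small partition [l] avoids the hook length k+1
   exactly when [a - k - 1] is not in the Maya diagram {j - l'_j}, i.e. when it
   is [l_i - i] for some i >= 1; below, [d = k + 1 - i]. *)
Lemma core_cons k a l d : is_partition (a :: l) -> sumn l <= k -> d <= k ->
  a = d + part l (k - d) -> is_core k (a :: l) /\ deg k (a :: l) = sumn l + d.
Proof.
move=> Pal lk dk Ea; have Pl : is_partition l := is_partition_behead Pal.
have hk j : j < a -> if j < part l (k - d) then k.+1 < hook (a :: l) 0 j else hook (a :: l) 0 j <= k.
  move=> ja; rewrite hook_cons_0 //.
  by have := conj_part_gt (k - d) j Pl; case: (ltnP j (part _ _)) => H; case: (ltnP (k - d)) => // H' _ /=; lia.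
split.
  rewrite /is_core Pal /=; apply/allP => [[[|i] j]]; rewrite mem_cells /=.
    by rewrite ?part_cons0 => /hk; case: ifP => _; lia.
  rewrite /part /= -/(part l i) => jl.
  rewrite hook_cons_S; last by apply: leq_trans jl (@part_le _ 0 i.+1 Pal (leq0n _)).
  by have := hook_le_sumn Pl jl; lia.
rewrite deg_cons // (deg_small Pl) // addnC; congr addn.
rewrite -[RHS](addnK (part l (k - d))) -Ea -count_iota_geq; apply: eq_in_count => j.
by rewrite mem_iota /= add0n => /hk; case: ltnP; lia.
Qed.

Lemma core_consP k a l : is_core k (a :: l) -> sumn l <= k ->
  exists2 d, d <= k & a = d + part l (k - d) /\ deg k (a :: l) = sumn l + d.
Proof.
move=> Cal lk; have /andP[Pal /allP Hal] := Cal.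
have Pl : is_partition l := is_partition_behead Pal.
have l0 : part l k = 0.
  by apply/eqP; rewrite -leqn0 leqNgt; apply/negP => /(part_index_lt_sumn Pl); lia.
(* The parameter is the largest [d] satisfying [P]; [d = 0] qualifies because a partition of size at
   most [k] has no row of index [k]. *)
pose P d := (d <= k) && (d + part l (k - d) <= a).
have exP : exists d, P d by exists 0; rewrite /P subn0 l0.
have bP d : P d -> d <= k by case/andP.
case: (ex_maxnP exP bP) => d /andP[dk da] dmax.
have {}da : a = d + part l (k - d).
  apply/eqP; rewrite eq_sym eqn_leq da /= leqNgt; apply/negP => H.
  (* If equality failed, column [a - d.+1] would contain exactly [k - d] cells of [l]: at most, by
     the strict inequality, and at least, by maximality of [d]. Its bottom cell would have the
     forbidden hook length [d.+1 + (k - d)]. *)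
  have ja : a - d.+1 < a by lia.
  have := Hal (0, a - d.+1); rewrite mem_cells ?part_cons0 => /(_ ja) /=.
  rewrite hook_cons_0 // => /eqP; apply.
  have c1 : conj_part l (a - d.+1) <= k - d.
    by rewrite leqNgt conj_part_gt // -leqNgt; lia.
  suff c2 : k - d <= conj_part l (a - d.+1) by lia.
  have [/eqP ->//|nz] := boolP (k - d == 0).
  have kd : k - d = (k - d.+1).+1 by lia.
  rewrite kd conj_part_gt //.
  have : ~~ P d.+1 by apply/negP => /dmax; rewrite ltnn.
  by rewrite /P; lia.
exists d => //; split=> //.
by case: (core_cons Pal lk dk da).
Qed.

Lemma bump_core k l : 0 < k -> is_partition l -> sumn l <= k ->
  is_core k (Defs.bump k l) /\ deg k (Defs.bump k l) = sumn l + k.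
Proof.
move=> k0 Pl lk; apply: core_cons => //; last by rewrite subnn.
by rewrite is_partition_cons Pl; lia.
Qed.

(** When the rows above the first form a small partition, all their cells count in the degree, so
    this is the number of cells of hook at most [k] in the first row: the parameter [d] of
    [core_consP]. *)
Definition row_deg k g := deg k g - sumn (behead g).

Lemma core_row_deg k g : is_core k g -> g != [::] -> sumn (behead g) <= k ->
  [/\ row_deg k g <= k, part g 0 = row_deg k g + part g (k - row_deg k g).+1
    & deg k g = sumn (behead g) + row_deg k g].
Proof.
case: g => // a l Cal _ /(core_consP Cal)[d dk [Ea Ed]].
by rewrite /row_deg Ed addKn -part_behead.
Qed.

(* If [row_deg] dropped, the rows k - d and k - d' would each have to absorb all
   the added cells. *)
Lemma strong_cover_step k g g' : strong_cover k g g' -> part g 0 < part g' 0 ->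
  g != [::] -> sumn (behead g') <= k ->
  (row_deg k g' = (row_deg k g).+1 /\ forall s, part g' s.+1 = part g s.+1) \/
  (row_deg k g' = row_deg k g /\
   forall s, part g' s.+1 = part g s.+1 + (s == k - row_deg k g)).
Proof.
case/and4P=> Cg Cg' /subdiagP sub /eqP Ed lt0 g0 g'k.
have g'0 : g' != [::] by case: (g') lt0.
have subb i : part (behead g) i <= part (behead g') i by rewrite !part_behead.
have gk := leq_trans (sumn_sub subb) g'k.
have [dk Ea ED] := core_row_deg Cg g0 gk.
have [dk' Ea' ED'] := core_row_deg Cg' g'0 g'k.
set d := row_deg k g in dk Ea ED *; set d' := row_deg k g' in dk' Ea' ED' *.
have Pg' : is_partition g' by case/andP: Cg'.
have Pg : is_partition g by case/andP: Cg.
have sle := sumn_sub subb.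
case: (ltngtP d d') => dd.
- left; split; first lia.
  by move=> s; rewrite -!part_behead; apply/esym/(sumn_sub_eq subb); lia.
- have := @sumn_sub2 _ _ (k - d) (k - d') subb; rewrite !part_behead.
  have := @part_le g' (k - d).+1 (k - d').+1 Pg'; have := @part_le g (k - d).+1 (k - d').+1 Pg; lia.
right; split=> // s; case: eqP => [->|/eqP ne].
  have := sumn_sub1 (k - d) subb; rewrite !part_behead -dd in Ea' *; lia.
have := sumn_sub2 subb ne; rewrite !part_behead -dd in Ea' *; have := sub s.+1; lia.
Qed.

(** * Order in which a chain of covers modifies the rows *)

Section Walk.
Variables (k m : nat) (d : nat -> nat) (g : nat -> nat -> nat).
Hypothesis step : forall j, j < m ->
  (d j.+1 = (d j).+1 /\ forall s, g j.+1 s = g j s) \/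
  (d j.+1 = d j /\ forall s, g j.+1 s = g j s + (s == k - d j)).

(** [d] never decreases, so the active row [k - d] only moves to smaller indices: those below it are
    still untouched, and those beyond it are already final ([walk_high]). *)
Lemma walk_low j s : j <= m -> s < k - d j -> g j s = g 0 s.
Proof.
elim: j => // j IH jm; case: (step jm) => [[E H]|[E H]] sd; rewrite H.
  by apply: IH; lia.
by rewrite (_ : (s == _) = false) ?addn0 ?IH //; lia.
Qed.

Lemma walk_high j s : j <= m -> k - d j < s -> g j s = g m s.
Proof.
move=> jm; rewrite -{1}(subKn jm); rewrite -{2}(subKn jm).
elim: (m - j) (leq_subr j m) => [|t IH] tm; first by rewrite subn0.
have E1 : (m - t.+1).+1 = m - t by lia.
have lt : m - t.+1 < m by lia.
case: (step lt) => [[E H]|[E H]] sd; rewrite E1 in E H.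
  by rewrite -H IH; lia.
by have := H s; rewrite -IH; lia.
Qed.

Lemma walk_crosses e : d 0 <= e -> e < d m -> exists2 j, j < m & d j = e /\ d j.+1 = e.+1.
Proof.
elim: m step => [|m' IH] st; first lia.
move=> d0 em; case: (ltnP e (d m')) => H.
  by case: (IH (fun j jm => st j (leqW jm)) d0 H) => j jm ?; exists j => //; apply: leqW.
by exists m' => //; case: (st m' (ltnSn _)) => [[E _]|[E _]]; lia.
Qed.
End Walk.

(** * Structure of a bottom strong strip *)

Section Strip.
Variables (k : nat) (l nu : seq nat) (m : nat) (ch : seq (seq nat)).
Hypotheses (k0 : 0 < k) (Pl : is_partition l) (lk : sumn l <= k).
Hypotheses (Cnu : is_core k nu) (mk : m <= k.-1) (Hch : bstrip_chain k nu (Defs.bump k l) m ch).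
Local Notation g j := (nth [::] ch j).

Lemma chain_cover j : j < m -> strong_cover k (g j) (g j.+1) /\ part (g j) 0 < part (g j.+1) 0.
Proof. by move=> jm; case: Hch => _ _ _ _ /(_ j.+1 jm). Qed.

Lemma chain_deg j : j <= m -> deg k (g j) = deg k nu + j.
Proof.
elim: j => [|j IH] jm; first by case: Hch => _ -> _ _ _; rewrite addn0.
have [/and4P[_ _ _ /eqP-> _]] := chain_cover jm.
by rewrite IH ?addnS // ltnW.
Qed.

(** Each cover raises the degree by one and the chain ends at the bumped core. With [m = k - mu_i]
    this reads [deg nu = sumn l + mu_i], which is how the weight becomes a number of cells. *)
Lemma strip_deg : deg k nu + m = sumn l + k.
Proof.
rewrite -chain_deg //; case: Hch => _ _ -> _ _.
by case: (bump_core k0 Pl lk).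
Qed.

Lemma chain_core j : j <= m -> is_core k (g j).
Proof.
case: j => [|j] jm; first by case: Hch => _ -> _ _ _.
by have [/and4P[_ -> _ _]] := chain_cover jm.
Qed.

Lemma nu_neq0 : nu != [::].
Proof. by apply/eqP => E; have := strip_deg; rewrite E; have := deg_small (k := k) (l := [::]); rewrite /deg /=; lia. Qed.

Lemma chain_neq0 j : j <= m -> g j != [::].
Proof.
case: j => [|j] jm; first by case: Hch => _ -> _ _ _; apply: nu_neq0.
by have [_] := chain_cover jm; case: (g j.+1).
Qed.

Lemma chain_sub j i : j <= m -> part (g j) i <= part (Defs.bump k l) i.
Proof.
move=> jm; rewrite -(subKn jm); elim: (m - j) (leq_subr j m) => [|t IH] tm.
  by rewrite subn0; case: Hch => _ _ -> _ _.
have E1 : (m - t.+1).+1 = m - t by lia.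
have lt : m - t.+1 < m by lia.
have [/and4P[_ _ /subdiagP H _] _] := chain_cover lt.
by apply: leq_trans (H i) _; rewrite E1; apply: IH; lia.
Qed.

Lemma chain_behead_le j : j <= m -> sumn (behead (g j)) <= k.
Proof.
move=> jm; apply: leq_trans lk; apply: sumn_sub => i; rewrite part_behead.
exact: chain_sub jm.
Qed.

Lemma chain_row_deg j : j <= m ->
  [/\ row_deg k (g j) <= k, part (g j) 0 = row_deg k (g j) + part (g j) (k - row_deg k (g j)).+1
    & deg k (g j) = sumn (behead (g j)) + row_deg k (g j)].
Proof.
by move=> jm; apply: core_row_deg; [apply: chain_core|apply: chain_neq0|apply: chain_behead_le].
Qed.

Lemma chain_step j : j < m ->
  (row_deg k (g j.+1) = (row_deg k (g j)).+1 /\ forall s, part (g j.+1) s.+1 = part (g j) s.+1) \/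
  (row_deg k (g j.+1) = row_deg k (g j) /\
   forall s, part (g j.+1) s.+1 = part (g j) s.+1 + (s == k - row_deg k (g j))).
Proof.
move=> jm; have [H1 H2] := chain_cover jm.
by apply: strong_cover_step => //; [apply/chain_neq0/ltnW|apply: chain_behead_le].
Qed.

Lemma strip_upper s : part nu s.+1 <= part l s.
Proof. by have := @chain_sub 0 s.+1 (leq0n _); case: Hch => _ -> _ _ _. Qed.

(** Otherwise column [nu_s] would meet the strip in both rows [s] and [s + 1], because row [s + 1]
    of the bumped shape is row [s] of [l]; a horizontal strip forbids this. *)
Lemma strip_lower s : part l s <= part nu s.
Proof.
rewrite leqNgt; apply/negP => H.
have Pnu : is_partition nu by case/andP: Cnu.
case: Hch => _ _ _ /andP[_ /allP Hs] _.
set j := part nu s in H.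
have js : j < part (Defs.bump k l) s.
  by apply: leq_trans H _; case: (s) => [|t]; [apply: leq_addl|apply: part_leS].
have PB : is_partition (Defs.bump k l) by case: (bump_core k0 Pl lk) => /andP[].
have jB : j \in iota 0 (part (Defs.bump k l) 0).
  by rewrite mem_iota add0n (leq_trans js (part_le PB (leq0n _))).
have := Hs j jB.
have sl : s < size l by rewrite -part_gt0 //; lia.
rewrite leqNgt => /negP; apply.
have sub2 : {subset [:: s; s.+1] <= [seq i <- iota 0 (size (Defs.bump k l)) |
    (part nu i <= j) && (j < part (Defs.bump k l) i)]}.
  move=> i; rewrite !inE mem_filter mem_iota /= => /orP[]/eqP->.
    by rewrite leqnn js /=; lia.
  by rewrite (part_leS _ Pnu) /= ltnS sl andbT.
have := uniq_leq_size _ sub2; rewrite size_filter; apply.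
by rewrite /= inE; lia.
Qed.

Hypothesis nuk : deg k nu <= k.

(** If the tail of [nu] had a row of index [k - d], it would have more than [k - d] cells, and the
    degree would exceed [k]. So that row is empty, the first row has length [d], and every cell of
    [nu] counts. *)
Lemma strip_row0 : row_deg k nu = part nu 0 /\ deg k nu = sumn nu.
Proof.
have := chain_row_deg (leq0n m); case: Hch => _ -> _ _ _ [dk Ea Ed].
have Pnu : is_partition nu by case/andP: Cnu.
suff H0 : part nu (k - row_deg k nu).+1 = 0.
  have En : sumn nu = part nu 0 + sumn (behead nu) by case: (nu) nu_neq0.
  by move: Ea Ed; rewrite H0; lia.
apply/eqP; rewrite -leqn0 leqNgt -part_behead; apply/negP.
by move=> /(part_index_lt_sumn (is_partition_behead Pnu)); lia.
Qed.

(* Non-tail cells of the ribbons come from the steps which raise [row_deg]. *)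
Lemma strip_gaps x :
  (exists2 j, 0 < j <= m & (part (g j.-1) 0).+2 <= x <= part (g j) 0) <->
  (exists s c, [/\ 0 < s, part l s <= c < part nu s & x + s = k + 2 + c]).
Proof.
have [r0 dn] := strip_row0; have Pnu : is_partition nu by case/andP: Cnu.
pose d j := row_deg k (g j); pose h j s := part (g j) s.+1.
have st : forall j, j < m -> (d j.+1 = (d j).+1 /\ forall s, h j.+1 s = h j s) \/
  (d j.+1 = d j /\ forall s, h j.+1 s = h j s + (s == k - d j)) := chain_step.
have g0 : g 0 = nu by case: Hch.
have gm : g m = Defs.bump k l by case: Hch.
have A j : j <= m -> part (g j) 0 = d j + h j (k - d j) by case/chain_row_deg.
have D j : j <= m -> d j <= k by case/chain_row_deg.
split.
  case=> [[//|j]] jm; rewrite [j.+1.-1]/= => xj; have jm' : j <= m := ltnW jm.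
  case: (st j jm) => [[E H]|[E H]]; last first.
    by move: xj; rewrite !A // E H eqxx; lia.
  exists (k - d j), (x + (k - d j) - (k + 2)).
  have := D _ jm; have := D _ jm'; move: xj; rewrite !A // E H => xj d1 d2.
  (* Put [s = k - d j]. Row [s] of the tail is already that of [l] and row [s - 1] of the tail is
     still row [s] of [nu], so the ribbon runs from column [d j + l_s + 1] to column
     [d j + 1 + nu_s]. *)
  have U : h j (k - d j) = part l (k - d j).
    by rewrite -H (walk_high st jm) ?/h ?gm // E; lia.
  have L : h j (k - (d j).+1) = part nu (k - d j).
    by rewrite (walk_low st jm') ?/h ?g0; [congr part|]; lia.
  by move: xj; rewrite U L; split; lia.
case=> s [c [s0 /andP[c1 c2] Ex]]; case: s s0 c1 c2 Ex => // s _ c1 c2 Ex.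
have s1 := @part_hook_le nu s.+1 Pnu (leq_ltn_trans (leq0n _) c2).
have dm : d m = k.
  by rewrite /d gm /row_deg (proj2 (bump_core k0 Pl lk)) /=; lia.
(* [row_deg] climbs by unit steps from [nu_0] to [k]. Since row [s.+1] of [nu] is nonempty,
   [nu_0 + s.+1 <= k], so the value [k - s.+1] is passed. *)
have [||j jm [E1 E2]] := walk_crosses st (e := k - s.+1).
- by rewrite /d g0 r0; lia.
- by rewrite dm; lia.
exists j.+1; rewrite // [j.+1.-1]/=.
have jm' : j <= m := ltnW jm.
case: (st j jm) => [[_ H]|[]]; last by lia.
rewrite !A // E1 E2; have -> : k - (k - s.+1) = s.+1 by lia.
have -> : k - (k - s.+1).+1 = s by lia.
rewrite -H (walk_high st jm); last by rewrite E2; lia.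
rewrite H (walk_low st jm'); last by rewrite E1; lia.
rewrite /h g0 gm; move: c1 c2; rewrite /part /=; lia.
Qed.
End Strip.

(** * Bottom strong strips from horizontal strips *)

Lemma is_partitionI l : (forall i, part l i.+1 <= part l i) ->
  (forall i, i < size l -> 0 < part l i) -> is_partition l.
Proof.
move=> H1 H2; apply/andP; split; first by apply/(sortedP 0) => i _; apply: H1.
by apply/(all_nthP 0).
Qed.

Lemma sumn_incr_nth s i : sumn (incr_nth s i) = (sumn s).+1.
Proof.
elim: s i => [|a s IH] [|i] //=; last by rewrite IH addnS.
by elim: i => //= i ->.
Qed.

Lemma strong_cover_cons k a l d a' l' d' :
  is_partition (a :: l) -> is_partition (a' :: l') -> sumn l <= k -> sumn l' <= k ->
  d <= k -> d' <= k -> a = d + part l (k - d) -> a' = d' + part l' (k - d') ->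
  a <= a' -> (forall i, part l i <= part l' i) -> sumn l' + d' = (sumn l + d).+1 ->
  strong_cover k (a :: l) (a' :: l').
Proof.
move=> P P' lk lk' dk dk' E E' aa sub S.
have [C D] := core_cons P lk dk E; have [C' D'] := core_cons P' lk' dk' E'.
by rewrite /strong_cover C C' D D' S eqxx andbT; apply/subdiagP => [[]].
Qed.

(** The chain is built from its bottom: while row [k - d] of [s] is shorter than that of [l], it
    receives a cell, and otherwise [d] is raised. The last hypothesis says that [m] counts the
    missing cells plus the missing increments of [d], so [m = 0] forces [s = l] and [d = k]. *)
Lemma bstrip_chain_from k l m d s : 0 < k -> is_partition l -> sumn l <= k ->
  is_partition s -> (forall i, part s i <= part l i) -> 0 < d <= k ->
  part s 0 <= d + part s (k - d) ->
  (forall i, k - d < i -> part s i = part l i) ->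
  (forall i, i < k - d -> part l i.+1 <= part s i) ->
  m + sumn s = (k - d) + sumn l ->
  exists2 ch, [/\ size ch = m.+1, nth [::] ch 0 = (d + part s (k - d)) :: s
                & nth [::] ch m = Defs.bump k l]
    & forall j, 0 < j <= m -> strong_cover k (nth [::] ch j.-1) (nth [::] ch j) /\
        part (nth [::] ch j.-1) 0 < part (nth [::] ch j) 0.
Proof.
move=> k0 Pl lk; elim: m d s => [|m IH] d s Ps sub dk s0 hi lo Em.
  have ss := sumn_sub sub; have Ed : d = k by lia.
  have -> : s = l by apply: part_eq => //; apply: sumn_sub_eq => //; lia.
  exists [:: Defs.bump k l] => [|[] //]; split=> //.
  by rewrite Ed subnn.
have sk : sumn s <= k := leq_trans (sumn_sub sub) lk.
have Pas : is_partition ((d + part s (k - d)) :: s).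
  by rewrite is_partition_cons Ps s0; lia.
suff [d' [s' [P' sub' dk' s0' [hi' lo' Em' /andP[aa ss] S]]]] :
  exists d' s', [/\ is_partition s', forall i, part s' i <= part l i, 0 < d' <= k,
    part s' 0 <= d' + part s' (k - d') &
    [/\ (forall i, k - d' < i -> part s' i = part l i),
        (forall i, i < k - d' -> part l i.+1 <= part s' i),
        m + sumn s' = (k - d') + sumn l, 
        (d + part s (k - d) < d' + part s' (k - d')) && (sumn s' + d' == (sumn s + d).+1)
       & (forall i, part s i <= part s' i)]].
  have [ch [c1 c2 c3] c4] := IH d' s' P' sub' dk' s0' hi' lo' Em'.
  exists (((d + part s (k - d)) :: s) :: ch); first by split=> //=; rewrite c1.
  case=> [//|[|j]] jm; last exact: (c4 j.+1).
  rewrite /= c2; split=> //; apply: (@strong_cover_cons _ _ _ d _ _ d') => //.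
  - by rewrite is_partition_cons P' s0'; lia.
  - exact: leq_trans (sumn_sub sub') lk.
  - by case/andP: dk.
  - by case/andP: dk'.
  - exact: ltnW.
  - exact/eqP.
case: (ltnP (part s (k - d)) (part l (k - d))) => cmp.
  have E i : part (incr_nth s (k - d)) i = (k - d == i) + part s i by rewrite /part nth_incr_nth.
  exists d, (incr_nth s (k - d)); split=> //.
  (* By [lo], the preceding row has at least [part l (k - d)] cells, hence strictly more than row
     [k - d] of [s], which may therefore be lengthened. *)
  - apply: is_partitionI => i; rewrite !E.
      have := part_leS i Ps; case: (ltnP i (k - d)) => ik; last by lia.
      have := lo i ik; have := part_leS i Pl.
      case: eqP => [eq|]; last by lia.
      by rewrite -eq; have := eq; lia.
    case: eqP => // /eqP ne; rewrite add0n size_incr_nth part_gt0 //.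
    move=> H; rewrite -part_gt0 //.
    case: (ltnP i (size s)) => [|H1]; first by rewrite part_gt0.
    have ik : i < k - d by move: H; case: ifP; lia.
    have := lo i ik; have := @part_le l i.+1 (k - d) Pl ik; lia.
  - by move=> i; rewrite E; case: eqP => [<-|_]; rewrite ?add1n ?add0n.
  - by rewrite !E eqxx; case: eqP => [e|]; [rewrite -e|]; lia.
  rewrite sumn_incr_nth; split.
  - by move=> i ki; rewrite E (_ : _ == _ = false) ?hi //; lia.
  - by move=> i ki; rewrite E; apply: leq_trans (lo i ki) (leq_addl _ _).
  - lia.
  - by rewrite E eqxx; lia.
  - by move=> i; rewrite E; apply: leq_addl.
have Ekd : part s (k - d) = part l (k - d) by have := sub (k - d); lia.
have dlt : d < k.
  rewrite ltnNge; apply/negP => kd.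
  have : s = l; last by move=> E; move: Em; rewrite E; lia.
  apply: part_eq => // i; case: (ltnP (k - d) i) => [/hi //|ik].
  by have -> : i = k - d by lia.
have mon := part_le Ps (leq_subr 1 (k - d)).
exists d.+1, s; have -> : k - d.+1 = k - d - 1 by lia.
split=> //; try lia; split=> //; try lia.
- move=> i ki; case: (eqVneq i (k - d)) => [->//|ne]; apply: hi; lia.
- move=> i ki; apply: lo; lia.
Qed.

Lemma count_le1 (T : eqType) (P : pred T) (s : seq T) : uniq s ->
  {in s &, forall x y, P x -> P y -> x = y} -> count P s <= 1.
Proof.
move=> us H; rewrite -size_filter leqNgt; apply/negP.
have := filter_uniq P us.
have : all (mem s) (filter P s) by apply/allP => x; rewrite mem_filter => /andP[].
have := filter_all P s.
case: (filter P s) => [|x [|y t]] //= /and3P[Px Py _] /and3P[sx sy _].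
by rewrite (H x y) // inE eqxx.
Qed.

Lemma bottom_strong_strip_exists k l nu m : 0 < m <= k ->
  is_partition l -> is_partition nu -> sumn nu = sumn l + m -> sumn nu <= k ->
  (forall s, part l s <= part nu s) -> (forall s, part nu s.+1 <= part l s) ->
  bottom_strong_strip k nu (Defs.bump k l) (k - m).
Proof.
move=> mk Pl Pn Sn nk lo up; have k0 : 0 < k by lia.
have lk : sumn l <= k by lia.
have [CB _] := bump_core k0 Pl lk.
split=> //; [exact: small_core|lia|].
have nu0 : 0 < part nu 0.
  by rewrite part_gt0 //; case: (nu) Sn => //=; lia.
have En : nu = part nu 0 :: behead nu by case: (nu) nu0.
have Es : sumn nu = part nu 0 + sumn (behead nu) by rewrite {1}En.
(* Since [nu] is small, its tail has no row of index [k - nu_0]. Hence the construction started at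
   [d = nu_0] with the tail of [nu] has [nu] itself as its first core. *)
have z : part (behead nu) (k - part nu 0) = 0.
  rewrite part_behead; apply/eqP; rewrite -leqn0 leqNgt; apply/negP => H.
  by have := part_hook_le Pn H; lia.
have z' i : k - part nu 0 < i -> part l i = 0.
  move=> ki; apply/eqP; rewrite -leqn0 leqNgt; apply/negP => H.
  by have := lo i; have := part_hook_le Pn (i := i); lia.
have [||||||ch [c1 c2 c3] c4] :=
  @bstrip_chain_from k l (k - m) (part nu 0) (behead nu) k0 Pl lk (is_partition_behead Pn).
- by move=> i; rewrite part_behead.
- lia.
- by rewrite z part_behead; have := part_leS 0 Pn; lia.
- by move=> i ki; rewrite z' //; apply/eqP; rewrite -leqn0 -z; apply: part_le => //; [exact: is_partition_behead|exact: ltnW].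
- by move=> i _; rewrite part_behead.
- lia.
exists ch; split=> //; first by rewrite c2 z addn0 -En.
apply/andP; split.
  apply/subdiagP => [[|s]]; last exact: up.
  by apply: (@leq_trans k); [lia|exact: leq_addr].
apply/allP => j _; apply: count_le1; first exact: iota_uniq.
have PB : is_partition (Defs.bump k l) by case/andP: CB.
(* Row [i'] of the bumped shape is row [i' - 1] of [l], and [l] is contained in [nu]. *)
have F i i' : part nu i <= j -> j < part (Defs.bump k l) i' -> i' <= i.
  move=> H1 H2; rewrite leqNgt; apply/negP => ii.
  have : part (Defs.bump k l) i' <= part l i := part_le PB ii.
  by have := lo i; lia.
move=> i i' _ _ /andP[a b] /andP[a' b']; apply/eqP; rewrite eqn_leq.
by rewrite (F i' i) // (F i i').
Qed.

Lemma sumn_telescope (b : nat -> nat) m : (forall j, j < m -> b j < b j.+1) ->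
  sumn [seq b j - b j.-1 | j <- iota 1 m] = b m - b 0 /\ b 0 <= b m.
Proof.
elim: m => [|m IH] H; first by rewrite subnn.
have [E L] := IH (fun j jm => H j (leqW jm)).
by rewrite -[in iota _ _](addn1 m) iotaD map_cat sumn_cat E /= add1n add0n addn0; have := H m (ltnSn _); lia.
Qed.

(** The ribbons of the strip provide the rows [s > 0] of [nu / l], by [strip_gaps], and the first
    appended ribbon provides row [0]. *)
Lemma mem_Vrow k mu A i x (l := nth [::] A i.-1) (nu := nth [::] A i) (m := nth 0 mu i.-1) :
  is_partition l -> 0 < sumn l -> 0 < m -> sumn l + m <= k ->
  bottom_strong_strip k nu (Defs.bump k l) (k - m) ->
  (x \in Vrow k mu A i) <->
  (exists s c, part l s <= c < part nu s /\ x + s = k + 2 + c).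
Proof.
move=> Pl l0 m0 lk [Cn CB mk Hch].
have k0 : 0 < k by lia.
have lk' : sumn l <= k by lia.
have Hc : bstrip_chain k nu (Defs.bump k l) (k - m) (row_chain k mu A i).
  exact: epsilon_spec Hch.
have Dn := strip_deg k0 Pl lk' Hc.
have nk : deg k nu <= k by lia.
have gaps := strip_gaps k0 Pl lk' Cn mk Hc nk x.
have [r0 dn] := strip_row0 k0 Pl lk' Cn mk Hc nk.
have lo := strip_lower k0 Pl lk' Cn mk Hc.
have up := strip_upper k0 Pl lk' Cn mk Hc.
have B0 : brk k mu A i 0 = part nu 0 by rewrite /brk; case: Hc => _ -> _ _ _.
have Bm : brk k mu A i (k - m) = k + part l 0 by rewrite /brk; case: Hc => _ _ -> _ _.
have inc j : j < k - m -> brk k mu A i j < brk k mu A i j.+1.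
  by case/(chain_cover Hc).
have [Es le0] := sumn_telescope inc.
have s_rowE : s_row k mu A i = k + part l 0 - part nu 0 by rewrite -B0 -Bm.
have r_rowE : r_row k mu A i = k - m.
  rewrite /r_row /ribbon_sizes count_map (@eq_in_count _ _ predT) ?count_predT ?size_iota //.
  by move=> [|j]; rewrite mem_iota // /row_m -/m => jm; rewrite [LHS]subn_gt0; apply: inc; lia.
have n0 := lo 0; have := sumn_sub1 0 lo => sm.
(* The prescribed size is [m + (k - m) + 1 - (k + l_0 - nu_0)]. The cap [k] is not exceeded because
   [nu_0 - l_0 <= m] and [l] is nonempty, so that [m < k]. *)
have extE : ext_len k mu A i = (part nu 0 - part l 0).+1.
  rewrite /ext_len s_rowE r_rowE -/m; rewrite B0 Bm in le0; lia.
have lenE : len_row k A i = k + part l 0 by [].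
rewrite /Vrow mem_cat extE; split.
  case/orP.
    case/flatten_mapP => j; rewrite !mem_iota /row_m -/m /brk => jm xj.
    have [|s [c [_ H1 H2]]] := proj1 gaps; last by exists s, c.
    by exists j; lia.
  rewrite mem_iota lenE => H.
  by exists 0, (x - (k + 2)); lia.
case=> [[|s] [c [H1 H2]]]; apply/orP.
  by right; rewrite mem_iota lenE; lia.
left; have [|j jm xj] := proj2 gaps; first by exists s.+1, c.
apply/flatten_mapP; exists j; rewrite !mem_iota /row_m -/m; first lia.
by rewrite /brk; lia.
Qed.

(** * Cyclic scans by reading order and by content *)

Notation cell := (nat * nat)%type.
Local Notation x0 := ((0, 0) : cell).

(* Cells are 0-based pairs (row, column): [rlt] is the order of the reading
   word, [clt] compares contents (column minus row). *)
Definition rlt (x y : cell) := (y.1 < x.1) || (x.1 == y.1) && (x.2 < y.2).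
Definition clt (x y : cell) := x.2 + y.1 < y.2 + x.1.

Lemma rlt_irr : irreflexive rlt. Proof. by move=> x; rewrite /rlt; lia. Qed.
Lemma rlt_trans : transitive rlt. Proof. by move=> y x z; rewrite /rlt; lia. Qed.

(** [s] is kept in reading order, so [last] is the nearest candidate to the left; if nothing lies
    left of [p], the scan wraps around to the end of [s]. This also serves [clt], since reading
    order refines to content order among cells of one letter. *)
Definition scan_left (cut : rel cell) (p : cell) (s : seq cell) : cell :=
  let f := [seq q <- s | cut q p] in last x0 (if f is [::] then s else f).

Fixpoint greedy_match (cut : rel cell) (ps s : seq cell) : seq cell :=
  if ps is p :: ps' then
    if s is [::] then [::] else
    let q := scan_left cut p s in q :: greedy_match cut ps' (rem q s)
  else [::].

Lemma greedy_match_nil cut ps : greedy_match cut ps [::] = [::]. Proof. by case: ps. Qed.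

Lemma greedy_match_cons cut p ps s : s != [::] ->
  greedy_match cut (p :: ps) s = scan_left cut p s :: greedy_match cut ps (rem (scan_left cut p s) s).
Proof. by case: s. Qed.

Lemma mem_last_cell (s : seq cell) : s != [::] -> last x0 s \in s.
Proof. by case: s => // a s _; rewrite /= mem_last. Qed.

Lemma scan_left_mem cut p s : s != [::] -> scan_left cut p s \in s.
Proof.
rewrite /scan_left => s0; case E: [seq q <- s | cut q p] => [|y t]; first exact: mem_last_cell.
have : last x0 (y :: t) \in y :: t by apply: mem_last_cell.
by rewrite -E mem_filter => /andP[].
Qed.

Lemma eq_scan_left cut cut' p s : {in s, cut^~ p =1 cut'^~ p} ->
  scan_left cut p s = scan_left cut' p s.
Proof. by move=> H; rewrite /scan_left (eq_in_filter H). Qed.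

Lemma size_greedy_match cut ps s : size (greedy_match cut ps s) = minn (size ps) (size s).
Proof.
elim: ps s => [|p ps IH] s; first by rewrite min0n.
case: (eqVneq s [::]) => [->|s0]; first by rewrite minn0.
rewrite greedy_match_cons //= IH size_rem ?scan_left_mem //.
by case: s s0 => //= a s _; rewrite minnSS.
Qed.

Lemma greedy_match_perm cut ps s : size s <= size ps -> perm_eq (greedy_match cut ps s) s.
Proof.
elim: ps s => [|p ps IH] s; first by case: s.
case: (eqVneq s [::]) => [->//|s0]; rewrite greedy_match_cons //= => sp.
have qs := scan_left_mem cut p s0.
rewrite perm_sym; apply: perm_trans (perm_to_rem qs) _.
rewrite perm_cons perm_sym; apply: IH; by rewrite size_rem //; case: (size s) sp.
Qed.

Lemma rlt_last (s : seq cell) y : pairwise rlt s -> y \in s -> y = last x0 s \/ rlt y (last x0 s).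
Proof.
elim/last_ind: s => // s z _; rewrite pairwise_rcons last_rcons => /andP[/allP H _].
by rewrite mem_rcons inE => /orP[/eqP|/H]; [left|right].
Qed.

Lemma pairwise_rlt_filter (a : pred cell) s : pairwise rlt s -> pairwise rlt (filter a s).
Proof. exact: subseq_pairwise (filter_subseq _ _). Qed.

Lemma pairwise_rlt_rem q (s : seq cell) : pairwise rlt s -> pairwise rlt (rem q s).
Proof. exact: subseq_pairwise (rem_subseq _ _). Qed.

Lemma pairwise_rlt_uniq (s : seq cell) : pairwise rlt s -> uniq s.
Proof. by rewrite uniq_pairwise; apply: sub_pairwise => x y; apply: contraTneq => ->; rewrite rlt_irr. Qed.

(** The implication in the premise treats the two kinds of scan together: if the pick lies left of
    [p], it is compared only with cells left of [p]; after wrapping, with all cells. *)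
Lemma scan_left_max (cut : rel cell) p (s : seq cell) y : pairwise rlt s -> y \in s ->
  (cut (scan_left cut p s) p -> cut y p) ->
  y = scan_left cut p s \/ rlt y (scan_left cut p s).
Proof.
move=> ps ys; rewrite /scan_left; case E: [seq q <- s | cut q p] => [|z t].
  by move=> _; apply: rlt_last.
have lm : last x0 (z :: t) \in z :: t by apply: mem_last_cell.
have cl : cut (last x0 (z :: t)) p by move: lm; rewrite -E mem_filter => /andP[].
move=> /(_ cl) cy; rewrite -E; apply: rlt_last; first exact: pairwise_rlt_filter.
by rewrite mem_filter cy.
Qed.

Lemma scan_left_cut (cut : rel cell) p (s : seq cell) y : y \in s -> cut y p -> cut (scan_left cut p s) p.
Proof.
move=> ys cy; rewrite /scan_left; case E: [seq q <- s | cut q p] => [|z t].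
  by have := mem_filter (cut^~ p) y s; rewrite /= cy ys E.
have lm : last x0 (z :: t) \in z :: t by apply: mem_last_cell.
by move: lm; rewrite -E mem_filter => /andP[].
Qed.

(* Cells of one row are met right to left, since a scan never starts inside a
   run of equal letters. *)
Lemma greedy_match_row_order ps s x y : pairwise rlt s ->
  (forall p, p \in ps -> x \in s -> y \in s -> rlt x p -> rlt y p) ->
  x \in s -> y \in s -> rlt x y -> x \in greedy_match rlt ps s ->
  index y (greedy_match rlt ps s) < index x (greedy_match rlt ps s).
Proof.
elim: ps s => [|p ps IH] s // Ps cutP xs ys xy.
have s0 : s != [::] by case: (s) xs.
rewrite greedy_match_cons //; set q := scan_left _ _ _.
have us := pairwise_rlt_uniq Ps.
case: (eqVneq q x) => [qx|qx].
  case: (@scan_left_max rlt p s y Ps ys); rewrite -/q ?qx.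
  - by apply: cutP => //; rewrite inE eqxx.
  - by move=> E; move: xy; rewrite E rlt_irr.
  - by move=> yx; have := rlt_trans xy yx; rewrite rlt_irr.
rewrite inE eq_sym (negbTE qx) /= (negbTE qx) => xb.
case: (eqVneq q y) => // qy; rewrite ltnS; apply: IH => //.
- exact: pairwise_rlt_rem.
- by move=> p' p'ps /mem_rem xs' /mem_rem ys'; apply: cutP => //; rewrite inE p'ps orbT.
- by rewrite mem_rem_uniq // inE eq_sym qx.
- by rewrite mem_rem_uniq // inE eq_sym qy.
Qed.

Definition blocked (u : cell) : pred cell := fun v => (v.1 == u.1.+1) && (u.2 < v.2).
Definition right_of (u : cell) : pred cell := fun u' => (u'.1 == u.1) && (u.2 < u'.2).

Lemma count_rem_le (a : pred cell) q s : count a (rem q s) <= count a s.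
Proof. by rewrite count_rem leq_subr. Qed.

(** A cell [v] in the row of [u] or lower is to the right in both orders. A higher one comes earlier
    in the word, and also in content unless its column is larger, which makes it blocked. *)
Lemma rlt_clt_same u v : ~~ blocked u v -> (v.1 <= u.1 -> u.2 < v.2) ->
  (u.1 < v.1 -> u.2 < v.2 -> v.1 = u.1.+1) -> rlt v u = clt v u /\ rlt u v = clt u v.
Proof.
case: u v => [a b] [c d]; rewrite /blocked /rlt /clt /= => H1 H2 H3.
by split; apply/idP/idP; lia.
Qed.

(** In the word, the cells strictly between [v] and [u] lie in the row of [v], right of [v], or in
    the row of [u], left of [u]. The last premise excludes the second kind. *)
Lemma blocked_next w u v q : right_of w u -> blocked w v -> rlt v q -> rlt q u ->
  (q.1 <= u.1 -> u.2 < q.2) -> blocked w q.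
Proof.
case: w u v q => [a b] [c d] [e f] [g h]; rewrite /right_of /blocked /rlt /=; lia.
Qed.

(* A cell [v] of letter i+1 which is left of [u] (of letter i) in the word but
   not in content is [blocked u].  The invariant [inv] says that such [v] are
   used up by the cells right of [u] before the scan starts from [u]; hence
   both orders make the same choices. *)
Lemma greedy_match_rlt_clt (ps s : seq cell) : pairwise rlt s ->
  (forall u v : cell, u \in ps -> v \in s -> v.1 <= u.1 -> u.2 < v.2) ->
  (forall u v : cell, u \in ps -> v \in s -> u.1 < v.1 -> u.2 < v.2 -> v.1 = u.1.+1) ->
  (forall i, i < size ps -> count (blocked (nth x0 ps i)) s <=
     count (right_of (nth x0 ps i)) (take i ps)) ->
  greedy_match rlt ps s = greedy_match clt ps s /\
  (forall r, r < size (greedy_match rlt ps s) ->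
     rlt (nth x0 ps r) (nth x0 (greedy_match rlt ps s) r) =
     clt (nth x0 ps r) (nth x0 (greedy_match rlt ps s) r)).
Proof.
elim: ps s => [|u ps IH] s // Ps h1 h3 inv.
case: (eqVneq s [::]) => [->//|s0].
have nb v : v \in s -> ~~ blocked u v.
  move=> vs; apply/negP => bv; have := inv 0 isT; rewrite take0 /= leqn0 => /eqP.
  by move/eqP; rewrite -leqn0 leqNgt -has_count => /hasPn/(_ v vs); rewrite bv.
have us : u \in u :: ps by rewrite inE eqxx.
have same v : v \in s -> rlt v u = clt v u /\ rlt u v = clt u v.
  by move=> vs; apply: rlt_clt_same; [apply: nb|apply: h1|apply: h3].
have qs := scan_left_mem rlt u s0.
have Eq : scan_left clt u s = scan_left rlt u s.
  by apply: eq_scan_left => v /same[].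
rewrite !greedy_match_cons // Eq; set q := scan_left rlt u s in qs Eq *.
have [||||E H] := IH (rem q s).
- exact: pairwise_rlt_rem.
- by move=> u' v u's /mem_rem; apply: h1; rewrite inE u's orbT.
- by move=> u' v u's /mem_rem; apply: h3; rewrite inE u's orbT.
- move=> i ip; have := inv i.+1 ip; rewrite /=; set w := nth x0 ps i => Hw.
  have wps : w \in u :: ps by rewrite inE mem_nth ?orbT.
  (* Only when [u] lies right of [w] in its row does consuming [u] lower the right-hand count. The
     pick [q] must then be a cell blocked by [w], so that the left-hand count drops as well. *)
  case rw: (right_of w u) Hw => Hw; last first.
    by apply: leq_trans (count_rem_le _ _ _) Hw.
  case bw: (has (blocked w) s); last first.
    by apply: leq_trans (count_rem_le _ _ _) _; move: bw; rewrite has_count; case: count.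
  suff bq : blocked w q by move: Hw; rewrite count_rem qs bq /=; lia.
  case/hasP: bw => v vs bv.
  have cv : rlt v u by move: bv rw; rewrite /blocked /right_of /rlt; lia.
  have cq : rlt q u by apply: scan_left_cut cv.
  case: (@scan_left_max rlt u s v Ps vs (fun _ => cv)) => [E|vq]; first by rewrite /q -E.
  by apply: blocked_next rw bv vq cq _; apply: h1.
by rewrite E; split=> // [[|r]] /=; [rewrite (same _ qs).2|rewrite ltnS -E => /H].
Qed.

(** * Reading words of cell sequences *)

(** The charge of a permutation in which letter [t] sits at position [nth d ms t.-1] and [lt] says
    left of; list indices start at 0, hence [t.-2] and [t.-1]. *)
Definition rel_charge (T : Type) (d : T) (lt : rel T) (ms : seq T) : nat :=
  sumn [seq sumn [seq nat_of_bool (lt (nth d ms t.-2) (nth d ms t.-1)) | t <- iota 2 i.-1]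
       | i <- iota 1 (size ms)].

Lemma perm_charge_rel (T : Type) (d : T) (lt : rel T) ms w : size w = size ms ->
  (forall t, 1 < t <= size ms ->
     (index t.-1 w < index t w) = lt (nth d ms t.-2) (nth d ms t.-1)) ->
  perm_charge w = rel_charge d lt ms.
Proof.
move=> E H; rewrite /perm_charge /rel_charge E; congr sumn; apply/eq_in_map => i.
rewrite mem_iota => Hi; congr sumn; apply/eq_in_map => t; rewrite mem_iota => Ht.
by rewrite H //; lia.
Qed.

Section ReadingPerm.
Variable cs : seq nat.
Local Notation c i := (nth 0 cs i.-1).

Definition cands i := [seq j <- iota 1 i.-1 | c j < c i].
Definition parent i :=
  last 0 [seq j <- cands i | c j == foldr maxn 0 [seq c j | j <- cands i]].

Lemma foldr_maxn_ge (s : seq nat) x : x \in s -> x <= foldr maxn 0 s.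
Proof.
elim: s => // a s IH; rewrite inE /= leq_max => /orP[/eqP->|/IH->]; first by rewrite leqnn.
by rewrite orbT.
Qed.

Lemma foldr_maxn_mem (s : seq nat) : s != [::] -> foldr maxn 0 s \in s.
Proof.
elim: s => // a s IH _ /=; rewrite inE; case: (eqVneq s [::]) => [->|s0].
  by rewrite maxn0 eqxx.
by rewrite /maxn; case: ifP => _; rewrite ?eqxx // IH ?orbT.
Qed.

Lemma sorted_ltn_last (s : seq nat) x : sorted ltn s -> x \in s -> x <= last 0 s.
Proof.
move=> ss xs; have [i Hi <-] := nthP 0 xs.
rewrite -nth_last; case: s ss xs Hi => // a s ss _ Hi.
rewrite (sorted_leq_nth (leT := leq)) ?inE //; first exact: leq_trans.
by move: ss; apply: sub_sorted => u v; apply: ltnW.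
Qed.

Lemma parentP i (p := parent i) : cands i != [::] ->
  [/\ 0 < p < i, c p < c i &
      forall j, 0 < j < i -> c j < c i -> c j <= c p /\ (c j = c p -> j <= p)].
Proof.
move=> ne; set best := foldr maxn 0 [seq c j | j <- cands i].
have : best \in [seq c j | j <- cands i] by apply: foldr_maxn_mem; case: (cands i) ne.
case/mapP=> j0 j0c Eb.
set s := [seq j <- cands i | c j == best].
have ps : p \in s.
  have : j0 \in s by rewrite mem_filter j0c Eb eqxx.
  by rewrite /p /parent -/best -/s; case: (s) => // a t _; rewrite /= mem_last.
have := ps; rewrite mem_filter mem_filter mem_iota => /and3P[/eqP cp cpi pi].
split=> //; first lia.
move=> j ji cji; have jc : j \in cands i by rewrite mem_filter cji mem_iota; lia.
split; first by rewrite cp; apply: foldr_maxn_ge; apply: map_f.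
move=> Ej; rewrite /p /parent -/best -/s; apply: sorted_ltn_last.
  by do 2 (apply: sorted_filter; first exact: ltn_trans); apply: iota_ltn_sorted.
by rewrite mem_filter Ej cp eqxx.
Qed.

Definition reading_step (w : seq nat) i :=
  if cands i is [::] then i :: w else insert_after w (parent i) i.

Definition partial_reading n := foldl reading_step [:: 1] (iota 2 n).

Lemma reading_permE : cs != [::] -> reading_perm cs = partial_reading (size cs).-1.
Proof. by rewrite /reading_perm /partial_reading /reading_step /parent /cands; case: cs. Qed.

Lemma partial_readingS n : partial_reading n.+1 = reading_step (partial_reading n) n.+2.
Proof. by rewrite /partial_reading -[in LHS](addn1 n) iotaD foldl_cat /= add2n. Qed.

Lemma insert_after_index (w : seq nat) p x z : p \in w -> x \notin w -> z \in w ->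
  index z (insert_after w p x) = index z w + (index p w < index z w).
Proof.
move=> pw xw zw; rewrite /insert_after; set u := take _ _; set v := drop _ _.
have zx : x != z by apply: contraNneq xw => ->.
have su : size u = (index p w).+1 by rewrite size_takel // index_mem.
have -> : index z w = index z (u ++ v) by rewrite cat_take_drop.
rewrite !index_cat /= (negbTE zx) su; case zu: (z \in u); last lia.
by have := zu; rewrite -index_mem su; lia.
Qed.

Lemma insert_after_index_new (w : seq nat) p x : p \in w -> x \notin w ->
  index x (insert_after w p x) = (index p w).+1.
Proof.
move=> pw xw; rewrite /insert_after index_cat ifN /= ?eqxx ?addn0 ?size_takel // ?index_mem //.
by apply: contra xw => /mem_take.
Qed.

Lemma perm_insert_after (w : seq nat) p x : perm_eq (insert_after w p x) (x :: w).
Proof.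
by rewrite /insert_after perm_catC /= perm_cons perm_catC cat_take_drop.
Qed.

(** The last clause is the one used for charge. The second and third carry the induction: they
    locate the earlier letters of larger column, and the letters descending from a given parent,
    relative to the place of insertion. *)
Definition reading_inv n (w := partial_reading n) :=
  [/\ perm_eq w (iota 1 n.+1),
      forall x y, 0 < y < x -> x <= n.+1 -> c x <= c y -> index x w < index y w,
      forall y, 0 < y <= n.+1 -> cands y != [::] -> index (parent y) w < index y w
    & forall t, 1 < t <= n.+1 -> (index t.-1 w < index t w) = (c t.-1 < c t)].

Lemma reading_invP n : reading_inv n.
Proof.
elim: n => [|n [Pw I1 I2 I3]].
  split=> //; try by move=> *; lia.
  by move=> [|[|y]].
set w := partial_reading n in Pw I1 I2 I3; set x := n.+2.
have mw z : (z \in w) = (0 < z < x) by rewrite (perm_mem Pw) mem_iota add1n.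
have xw : x \notin w by rewrite mw ltnn andbF.
rewrite /reading_inv partial_readingS -/w -/x; set w' := reading_step w x.
have P' : perm_eq w' (iota 1 n.+2).
  have : perm_eq (x :: w) (iota 1 n.+2).
    have -> : iota 1 n.+2 = rcons (iota 1 n.+1) x.
      by rewrite -[in LHS](addn1 n.+1) iotaD cats1 add1n.
    by rewrite perm_sym perm_rcons perm_cons perm_sym.
  apply: perm_trans; rewrite /w' /reading_step; case: (cands x) => // *.
  exact: perm_insert_after.
(* [f z] tells whether [z] lies right of the place where [x] is inserted, and is thus shifted by
   one; this treats insertion at the front and after the parent alike. *)
have [f [fE fx]] : exists f : nat -> bool,
    (forall z, z \in w -> index z w' = index z w + f z) /\
    (forall z, z \in w -> (index x w' < index z w') = f z) /\ 
    (forall z1 z2, z1 \in w -> z2 \in w -> index z1 w < index z2 w -> f z1 <= f z2) /\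
    (forall z, z \in w -> index z w' != index x w') /\
    (if cands x is [::] then forall z, f z else forall z, f z = (index (parent x) w < index z w)).
  rewrite /w' /reading_step; case Ec: (cands x) => [|q t].
    exists predT; split; last split; last split; last split => //.
    - by move=> z zw; rewrite /= ifN ?addn1 //; apply: contraNneq xw => ->.
    - by move=> z zw; rewrite /= eqxx ifN //; apply: contraNneq xw => ->.
    - by [].
    - by move=> z zw; rewrite /= eqxx ifN //; apply: contraNneq xw => ->.
  have [|p1 _ _] := @parentP x; first by rewrite Ec.
  have pw : parent x \in w by rewrite mw.
  exists (fun z => index (parent x) w < index z w); split; last split; last split; last split => //.
  - by move=> z zw; apply: insert_after_index.
  - by move=> z zw; rewrite insert_after_index_new // insert_after_index //; case: ltnP; lia.
  - by move=> z1 z2 _ _; lia.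
  - by move=> z zw; rewrite insert_after_index_new // insert_after_index //; case: ltnP; lia.
case: fx => fx [fmono [fne fdef]].
(* The letters [y < x] with [c x <= c y] are right of the place where [x] goes:
   follow the parents of [y] until they meet the parent of [x]. *)
have key y : 0 < y < x -> c x <= c y -> f y.
  have [y' Ey] := ubnP y; elim: y' y Ey => // N IH y yN yx cxy.
  case Ec: (cands x) fdef => [|q0 t0] fdef; first exact: fdef.
  have {}Ec : cands x != [::] by rewrite Ec.
  have [px cpx pmax] := parentP Ec; set p := parent x in px cpx pmax fdef.
  rewrite fdef; case: (ltngtP y p) => yp.
  - by apply: I1; lia.
  - have ney : cands y != [::].
      have : p \in cands y by rewrite mem_filter mem_iota; lia.
      by case: (cands y).
    have [qy cqy qmax] := parentP ney; set q := parent y in qy cqy qmax.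
    have qy' : index q w < index y w by apply: I2 => //; lia.
    have [||pq pq'] := qmax p; [lia|lia|]; case: (leqP (c x) (c q)) => cq.
      by have := IH q; rewrite fdef; lia.
    have [||qp qp'] := pmax q; [lia|lia|].
    have -> : p = q by lia.
    by [].
  - by move: cpx; rewrite -yp; lia.
split=> //.
- move=> a b ab a2 cab; case: (eqVneq a x) => [E|ne].
    by rewrite E in ab cab *; rewrite fx ?mw //; apply: key.
  have aw : a \in w by rewrite mw; lia.
  have bw : b \in w by rewrite mw; lia.
  have := I1 a b ab; rewrite !fE // => /(_ _ cab) H.
  have := fmono a b aw bw; lia.
- move=> y yx ney; have [py cpy _] := parentP ney; set p := parent y in py cpy *.
  have pw : p \in w by rewrite mw; lia.
  case: (eqVneq y x) => [E|ne].
    have := fne p pw; have := fx p pw; move: ney fdef; rewrite /p E.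
    by case: (cands x) => // q t _ ->; rewrite ltnn; lia.
  have yw : y \in w by rewrite mw; lia.
  have := I2 y; have := fmono p y pw yw; rewrite !fE // -/p; lia.
move=> t tx; case: (eqVneq t x) => [E|ne]; last first.
  have tw : t \in w by rewrite mw; lia.
  have tw' : t.-1 \in w by rewrite mw; lia.
  rewrite -I3; last lia.
  have := fmono t t.-1 tw tw'; have := fmono t.-1 t tw' tw; rewrite !fE //.
  have : index t w != index t.-1 w; last lia.
  apply/eqP => /(congr1 (nth 0 w)); rewrite !nth_index //; lia.
have xw' : t.-1 \in w by rewrite mw; lia.
have := fx _ xw'; have := fne _ xw'; rewrite E.
case: (leqP (c x) (c x.-1)) => cx; first by rewrite (key x.-1); lia.
have nex : cands x != [::].
  have : x.-1 \in cands x by rewrite mem_filter cx mem_iota; lia.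
  by case: (cands x).
have [px cpx pmax] := parentP nex; set p := parent x in px cpx pmax fdef.
have {}fdef z : f z = (index p w < index z w) by move: fdef; case: (cands x) nex.
(* Here [c x.-1 < c x], so [x.-1] is a candidate. The parent [p] is then [x.-1] itself or, by [I1],
   stands to its right; either way [x] lands right of [x.-1]. *)
rewrite fdef; have [||c1 c2] := pmax x.-1; [lia|lia|].
have := I1 x.-1 p; case: (ltngtP p x.-1) => cmp; try lia.
by rewrite cmp ltnn; lia.
Qed.
End ReadingPerm.

Lemma perm_charge_reading cs : perm_charge (reading_perm cs) = rel_charge 0 ltn cs.
Proof.
case: (eqVneq cs [::]) => [->//|ne].
rewrite reading_permE //; have [P _ _ I] := reading_invP cs (size cs).-1.
have s0 : 0 < size cs by case: (cs) ne.
apply: perm_charge_rel; first by rewrite (perm_size P) size_iota; lia.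
by move=> t Ht; rewrite I //; lia.
Qed.

(** * Charge as a sum over rounds of scanning *)

(* [layer_match L a] lists the cells of letter [a] in the order of the charge
   subwords (or of the sets E^r) which contain them; [L] gives the cells of each letter
   and [p0] is a fictitious starting point to the right of everything. *)
Fixpoint layer_match (cut : rel cell) (p0 : cell) (L : nat -> seq cell) (a : nat) : seq cell :=
  if a is a'.+1 then greedy_match cut (layer_match cut p0 L a') (L a)
  else nseq (size (L 1)) p0.

Lemma eq_layer_match cut p0 L L' : (forall a, 0 < a -> L a = L' a) ->
  layer_match cut p0 L =1 layer_match cut p0 L'.
Proof. by move=> E; elim=> [|a IH] /=; rewrite ?IH E. Qed.

Fixpoint first_picks (cut : rel cell) (p0 : cell) (L : nat -> seq cell) (a : nat) : cell :=
  if a is a'.+1 then scan_left cut (first_picks cut p0 L a') (L a) else p0.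

Definition round (M : nat -> seq cell) m r := [seq nth x0 (M a) r | a <- iota 1 m & r < size (M a)].

Lemma eq_round M M' m r r' :
  (forall a, a \in iota 1 m -> (r < size (M a)) = (r' < size (M' a)) /\
     nth x0 (M a) r = nth x0 (M' a) r') -> round M m r = round M' m r'.
Proof.
move=> E; rewrite /round (eq_in_filter (a2 := fun a => r' < size (M' a))); last by move=> a /E[].
by apply/eq_in_map => a; rewrite mem_filter => /andP[_ /E[]].
Qed.

(** [greedy_match] serves its list in order, so the first pick of a layer depends only on the first
    pick of the preceding one. Hence matching letter by letter agrees with extracting one charge
    subword after another. *)
Lemma layer_match_first cut p0 L (g := first_picks cut p0 L) a :
  (forall b, 0 < b -> size (L b.+1) <= size (L b)) ->
  0 < size (L 1) -> 0 < size (L a) \/ a = 0 ->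
  layer_match cut p0 L a = g a :: layer_match cut p0 (fun b => rem (g b) (L b)) a.
Proof.
move=> dec L1; have ne b : 0 < size (L b) -> L b != [::] by case: (L b).
elim: a => [_|a IH La] /=.
  by rewrite size_rem ?scan_left_mem ?ne //; case: (size (L 1)) L1.
have {}La : 0 < size (L a.+1) by case: La.
rewrite IH; first by rewrite greedy_match_cons ?ne.
by case: a La {IH} => [|a] La; [right|left; apply: leq_trans La (dec _ _)].
Qed.

Lemma layer_match_nil cut p0 L a : 0 < a -> L a = [::] -> layer_match cut p0 L a = [::].
Proof. by case: a => //= a _ ->; rewrite greedy_match_nil. Qed.

Lemma head_rev (T : Type) (d : T) s : head d (rev s) = last d s.
Proof. by elim/last_ind: s => // s z _; rewrite rev_rcons last_rcons. Qed.

Lemma pairwise_rlt_take_index (s : seq cell) u : pairwise rlt s -> u \in s ->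
  take (index u s) s = [seq q <- s | rlt q u].
Proof.
elim: s => // a s IH; rewrite pairwise_cons => /andP[/allP as_ Ps] /=; rewrite inE.
case: (eqVneq u a) => [->|ne] /=.
  rewrite ?eqxx /= rlt_irr ?take0 => _; apply/esym/eqP; rewrite -[_ == _]negbK -has_filter.
  by apply/hasPn => q /as_ aq; apply/negP => qa; have := rlt_trans aq qa; rewrite rlt_irr.
by move=> us; rewrite (as_ _ us) /= IH.
Qed.

(** * Charge subwords of a word of labelled cells *)

Section WordCharge.
Variables (ell : cell -> nat) (p0 : cell).
Definition layer (S : seq cell) a := [seq x <- S | ell x == a].

(** [cyc_order] lists the positions before [u] backwards, then the others backwards, and its first
    hit is the cell found by [scan_left]. The premise on [take] also admits the fictitious start:
    being absent from [S], it has index [size S]. *)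
Lemma mark_pick (S : seq cell) (u : cell) a : pairwise rlt S ->
  take (index u S) S = [seq q <- S | rlt q u] -> layer S a != [::] ->
  nth 0 [seq x <- cyc_order (size (map ell S)) (index u S) | nth 0 (map ell S) x == a] 0 =
  index (scan_left rlt u (layer S a)) S.
Proof.
move=> PS Etake La; have US := pairwise_rlt_uniq PS.
rewrite size_map; set p := index u S; set F := filter _ _.
have EF : map (nth x0 S) F = rev (layer (take p S) a) ++ rev (layer (drop p S) a).
  have nthS : map (nth x0 S) (iota 0 (size S)) = S by rewrite -[RHS](mkseq_nth x0).
  have sub (t : seq nat) : {subset t <= iota 0 (size S)} ->
    map (nth x0 S) [seq x <- t | nth 0 (map ell S) x == a] = layer (map (nth x0 S) t) a.
    move=> tS; rewrite /layer filter_map; congr map; apply: eq_in_filter => x /tS.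
    by rewrite mem_iota => xS /=; rewrite (nth_map x0).
  rewrite /F /cyc_order filter_cat !filter_rev map_cat !map_rev !sub.
  - by rewrite map_take map_drop nthS.
  - by move=> x /mem_drop.
  - by move=> x /mem_take.
have Epick : scan_left rlt u (layer S a) = head x0 (map (nth x0 S) F).
  rewrite EF /scan_left; have -> : [seq q <- layer S a | rlt q u] = layer (take p S) a.
    by rewrite Etake /layer -!filter_predI; apply: eq_filter => x /=; rewrite andbC.
  have EL : layer S a = layer (take p S) a ++ layer (drop p S) a.
    by rewrite /layer -filter_cat cat_take_drop.
  case: (layer (take p S) a) EL => [|z t] EL; first by rewrite /= head_rev EL.
  rewrite -head_rev; case E: (rev (z :: t)) => [|z' t'] //=.
  by have := size_rev (z :: t); rewrite E.
have F0 : F != [::].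
  apply/eqP => F0; move: EF; rewrite F0 /= -rev_cat /layer -filter_cat => /(congr1 size).
  rewrite size_rev => /esym/size0nil E0.
  have := scan_left_mem rlt u La; rewrite mem_filter => /andP[Ea].
  rewrite -[in X in _ \in X](cat_take_drop p S) mem_cat orbC -mem_cat => Es.
  have := mem_filter (fun x => ell x == a) (scan_left rlt u (layer S a)) (drop p S ++ take p S).
  by rewrite Es Ea E0.
have Fin : nth 0 F 0 \in F by apply: mem_nth; rewrite lt0n size_eq0.
have FS : nth 0 F 0 < size S.
  move: Fin; rewrite mem_filter mem_cat !mem_rev => /andP[_ /orP[/mem_take|/mem_drop]];
  by rewrite mem_iota.
by rewrite Epick; case: (F) F0 FS => // x t _ FS; rewrite /= index_uniq.
Qed.

Lemma mark_from_picks (S : seq cell) (g := first_picks rlt p0 (layer S)) n a :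
  pairwise rlt S -> (forall x, x \in S -> rlt x p0) ->
  (forall b, 0 < b <= a + n -> layer S b != [::]) ->
  mark_from (map ell S) (iota a.+1 n) (index (g a) S) =
  [seq index (g b) S | b <- iota a.+1 n].
Proof.
move=> PS pS; elim: n a => // n IH a ne.
have gm b : 0 < b <= a + n.+1 -> g b \in S.
  case: b => // b Hb; have := scan_left_mem rlt (g b) (ne _ Hb).
  by rewrite mem_filter => /andP[].
rewrite /= mark_pick //; last by apply: ne; lia.
  by rewrite -[scan_left _ _ _]/(g a.+1) IH // => b Hb; apply: ne; lia.
case: a {IH ne} gm => [|a] gm; last by apply: pairwise_rlt_take_index => //; apply: gm; lia.
have p0S : p0 \notin S by apply/negP => /pS; rewrite rlt_irr.
rewrite /g /= memNindex // take_size; apply/esym/all_filterP/allP => x; exact: pS.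
Qed.

(** The boolean treats the marked subword ([true]) and the remaining word ([false]) in one
    statement. *)
Lemma charge_sub (S G : seq cell) (b : bool) : uniq S -> {subset G <= S} ->
  [seq nth 0 (map ell S) q | q <- iota 0 (size (map ell S)) &
      (q \in [seq index x S | x <- G]) == b] =
  map ell [seq x <- S | (x \in G) == b].
Proof.
move=> US GS; rewrite size_map.
have ES : S = map (nth x0 S) (iota 0 (size S)) by rewrite -[LHS](mkseq_nth x0).
rewrite [in RHS]ES filter_map -map_comp.
have -> : [seq q <- iota 0 (size S) | (q \in [seq index x S | x <- G]) == b] =
   [seq q <- iota 0 (size S) | preim (nth x0 S) (fun x => (x \in G) == b) q].
  apply: eq_in_filter => q; rewrite mem_iota => qS /=; congr (_ == b).
  apply/mapP/idP => [[x xG ->]|qG]; first by rewrite nth_index ?GS.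
  by exists (nth x0 S q) => //; rewrite index_uniq.
apply/eq_in_map => q; rewrite mem_filter mem_iota => /andP[_ qS] /=.
by rewrite (nth_map x0).
Qed.

Lemma index_map_in (s : seq cell) x : {in s &, injective ell} -> x \in s ->
  index (ell x) (map ell s) = index x s.
Proof.
elim: s => // a s IH inj xs /=; case: (eqVneq a x) => [->|ne]; first by rewrite eqxx.
rewrite ifN; last by apply: contra ne => /eqP/inj ->; rewrite ?inE ?eqxx.
congr S; apply: IH; first by move=> u v us vs; apply: inj; rewrite inE ?us ?vs orbT.
by move: xs; rewrite inE eq_sym (negbTE ne).
Qed.

Lemma pairwise_rlt_index (s : seq cell) u v : pairwise rlt s -> u \in s -> v \in s ->
  (index u s < index v s) = rlt u v.
Proof.
move=> Ps us vs.
have := mem_filter (fun q => rlt q v) u s; rewrite -pairwise_rlt_take_index // us andbT => <-.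
by rewrite in_take_leq // index_size.
Qed.

Lemma perm_charge_marks (S : seq cell) h (g : nat -> cell) :
  pairwise rlt S -> (forall b, 0 < b <= h -> g b \in S /\ ell (g b) = b) ->
  perm_charge (map ell [seq x <- S | (x \in [seq g b | b <- iota 1 h]) == true]) =
  rel_charge x0 rlt [seq g b | b <- iota 1 h].
Proof.
move=> PS gS; set G := [seq g b | b <- _]; set K := filter _ _.
have GP x : x \in G -> exists2 b, 0 < b <= h & x = g b.
  by case/mapP=> b; rewrite mem_iota => Hb ->; exists b => //; lia.
have PK : pairwise rlt K := pairwise_rlt_filter _ PS.
have mK x : (x \in K) = (x \in G).
  rewrite mem_filter eqb_id; case xG: (x \in G) => //=.
  by case/GP: xG => b /gS[gb _] ->.
have inj : {in K &, injective ell}.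
  move=> x y; rewrite !mK => /GP[b /gS[_ eb] ->] /GP[b' /gS[_ eb'] ->].
  by rewrite eb eb' => ->.
have UG : uniq G.
  rewrite map_inj_in_uniq ?iota_uniq // => b b'; rewrite !mem_iota => Hb Hb' E.
  have [|_ <-] := gS b; first lia.
  have [|_ <-] := gS b'; first lia.
  by rewrite E.
have sK : size K = size G.
  by apply/perm_size/uniq_perm => //; apply: pairwise_rlt_uniq.
apply: perm_charge_rel; first by rewrite size_map.
rewrite size_map size_iota => t Ht.
have nG s : 0 < s <= h -> nth x0 G s.-1 = g s.
  by move=> Hs; rewrite (nth_map 0) ?size_iota ?nth_iota; [congr g| |]; lia.
have iG s : 0 < s <= h -> index s (map ell K) = index (g s) K.
  move=> Hs; have [_ es] := gS s Hs; rewrite -{1}es index_map_in // mK.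
  by apply: map_f; rewrite mem_iota; lia.
rewrite !iG; try lia.
rewrite pairwise_rlt_index //; try by rewrite mK; apply: map_f; rewrite mem_iota; lia.
by rewrite !nG; lia.
Qed.

Lemma iota1_filter (P : pred nat) h m : h <= m ->
  (forall a, 0 < a <= m -> P a = (a <= h)) -> [seq a <- iota 1 m | P a] = iota 1 h.
Proof.
move=> hm HP; rewrite -(subnKC hm) iotaD filter_cat.
rewrite (@eq_in_filter _ P predT); last by move=> a; rewrite mem_iota => Ha; rewrite HP /=; lia.
rewrite (@eq_in_filter _ P pred0 (iota (1 + h) _)); last first.
  by move=> a; rewrite mem_iota => Ha; rewrite HP /=; lia.
by rewrite filter_predT filter_pred0 cats0.
Qed.

Lemma word_charge_fuelS f w : w != [::] -> word_charge_fuel f.+1 w =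
  perm_charge [seq nth 0 w q | q <- iota 0 (size w) & (q \in first_marks w) == true] +
  word_charge_fuel f [seq nth 0 w q | q <- iota 0 (size w) & (q \in first_marks w) == false].
Proof.
move=> w0; rewrite (eq_filter (fun q => eqb_id (q \in first_marks w))).
by rewrite (eq_filter (fun q => eqbF_neg (q \in first_marks w))); case: w w0.
Qed.

(** Removing the first charge subword deletes the first pick from each layer, so the rounds of the
    remaining word are the later rounds of the original one. *)
Lemma word_charge_rounds m f (S : seq cell) : size S <= f -> pairwise rlt S ->
  (forall x, x \in S -> 0 < ell x <= m) -> (forall x, x \in S -> rlt x p0) ->
  (forall a, 0 < a -> size (layer S a.+1) <= size (layer S a)) ->
  word_charge_fuel f (map ell S) =
  sumn [seq rel_charge x0 rlt (round (layer_match rlt p0 (layer S)) m r) | r <- iota 0 (size (layer S 1))].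
Proof.
elim: f S => [|f IH] S; first by rewrite leqn0 => /eqP/size0nil->.
case: (eqVneq S [::]) => [->//|S0] Sf PS HS pS dec.
rewrite word_charge_fuelS; last by case: (S) S0.
set h := foldr maxn 0 (map ell S).
have h_in : h \in map ell S by apply: foldr_maxn_mem; case: (S) S0.
have [xh xhS Exh] := mapP h_in.
have hm : 0 < h <= m by rewrite Exh; apply: HS.
have decs a b : 0 < a <= b -> size (layer S b) <= size (layer S a).
  elim: b => [|b IHb]; first lia.
  move=> ab; case: (eqVneq a b.+1) => [->//|ne].
  by apply: leq_trans (dec b _) (IHb _); lia.
(* Layer sizes decrease with the letter and [h] occurs, so the nonempty layers are those of the
   letters up to [h], exactly the letters scanned by [first_marks]. *)
have ne a : 0 < a <= m -> (0 < size (layer S a)) = (a <= h).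
  move=> am; case: (leqP a h) => ah.
    apply: leq_trans (decs a h _); last lia.
    by rewrite size_filter -has_count; apply/hasP; exists xh => //; rewrite -Exh.
  apply/negbTE; rewrite -leqNgt leqn0 size_eq0 -[_ == _]negbK -has_filter.
  apply/hasPn => x xS; apply/eqP => Ex.
  by have := foldr_maxn_ge (map_f ell xS); rewrite Ex -/h; lia.
pose g := first_picks rlt p0 (layer S).
have ne' b : 0 < b <= h -> layer S b != [::] by move=> Hb; rewrite -size_eq0 -lt0n ne; lia.
have p0S : p0 \notin S by apply/negP => /pS; rewrite rlt_irr.
have Emarks : first_marks (map ell S) = [seq index x S | x <- [seq g b | b <- iota 1 h]].
  rewrite /first_marks -/h size_map -(memNindex p0S) -map_comp.
  exact: (@mark_from_picks S h 0).
have gS b : 0 < b <= h -> g b \in S /\ ell (g b) = b.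
  case: b => // b Hb; have := scan_left_mem rlt (g b) (ne' _ Hb).
  by rewrite mem_filter => /andP[/eqP-> ->].
set G := [seq g b | b <- iota 1 h] in Emarks.
have GS : {subset G <= S}.
  by move=> x /mapP[b]; rewrite mem_iota => Hb ->; case: (gS b) => //; lia.
have US := pairwise_rlt_uniq PS.
rewrite Emarks !charge_sub // perm_charge_marks //.
set S' := filter _ _.
have PS' : pairwise rlt S' := pairwise_rlt_filter _ PS.
have sub' x : x \in S' -> x \in S by rewrite mem_filter => /andP[].
have L' a : 0 < a -> layer S' a = rem (g a) (layer S a).
  move=> a0; rewrite (rem_filter _ (filter_uniq _ US)) /layer /S' -!filter_predI.
  apply: eq_in_filter => x xS /=; rewrite eqbF_neg andbC.
  case: eqP => Ex; rewrite ?andbF ?andbT //=; congr (~~ _).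
  have am := HS x xS; rewrite Ex in am.
  have ah : a <= h.
    by rewrite -ne // size_filter -has_count; apply/hasP; exists x => //; apply/eqP.
  apply/mapP/eqP => [[b]|->]; last by exists a => //; rewrite mem_iota; lia.
  rewrite mem_iota => Hb Exb; have [|_ eb] := gS b; first lia.
  by rewrite Exb -Ex Exb eb.
have sL' a : 0 < a -> size (layer S' a) = (size (layer S a)).-1.
  move=> a0; rewrite L' //; case: (eqVneq (layer S a) [::]) => [-> //|nea].
  case: a a0 nea => // a _ nea.
  by rewrite size_rem // scan_left_mem.
have s1 : 0 < size (layer S 1) by rewrite ne; lia.
rewrite IH //; first last.
- by move=> a a0; rewrite !sL' //; have := dec a a0; lia.
- by move=> x /sub'; apply: pS.
- by move=> x /sub'; apply: HS.
- rewrite -ltnS; apply: leq_trans Sf; rewrite /S' size_filter -[X in _ < X](count_predC (fun x => (x \in G) == false)).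
  rewrite -[X in X < _]addn0 ltn_add2l -has_count; apply/hasP.
  have [|g1 _] := gS 1; first lia.
  by exists (g 1) => //=; rewrite eqbF_neg negbK; apply: map_f; rewrite mem_iota; lia.
rewrite sL' //; set M := layer_match rlt p0 (layer S).
have ML : forall a, 0 < a <= m -> (0 < size (layer S a) -> M a = g a :: layer_match rlt p0 (layer S') a) /\
    (layer S a = [::] -> M a = [::] /\ layer_match rlt p0 (layer S') a = [::]).
  move=> a am; split=> Ha.
    rewrite /M layer_match_first //; last by left.
    by congr cons; apply: eq_layer_match => b b0; rewrite L'.
  by rewrite /M !layer_match_nil ?L' ?Ha //; lia.
case Es: (size (layer S 1)) s1 => [//|N] _; rewrite [N.+1.-1]/= [iota 0 N.+1]/= /=.
congr (_ + _).
  congr rel_charge; rewrite /G /round.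
  rewrite (_ : [seq a <- iota 1 m | 0 < size (M a)] = iota 1 h).
    apply/eq_in_map => a; rewrite mem_iota => Ha.
    by have [|-> //] := ML a; [lia|rewrite ne; lia].
  apply: iota1_filter; first lia.
  move=> a Ha; rewrite -ne //; have [m1 m2] := ML a Ha.
  case: (eqVneq (layer S a) [::]) => [E|nea]; first by rewrite E (m2 E).1.
  have l0 : 0 < size (layer S a) by rewrite lt0n size_eq0.
  by rewrite m1 // l0.
rewrite -[1]/(1 + 0) iotaDl -map_comp; congr sumn; apply: eq_map => r /=.
congr rel_charge; apply/esym/(@eq_round _ _ _ r.+1) => a.
rewrite mem_iota => Ha; have [|m1 m2] := ML a; first lia.
case: (eqVneq (layer S a) [::]) => [E|nea]; first by rewrite (m2 E).1 (m2 E).2 !nth_nil.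
by rewrite m1 // lt0n size_eq0.
Qed.
End WordCharge.

(** * Towers of partitions and semistandard tableaux *)

Lemma bottom_strong_strip_small k l nu m : is_partition l -> 0 < m -> sumn l + m <= k ->
  bottom_strong_strip k nu (Defs.bump k l) (k - m) ->
  [/\ is_partition nu, sumn nu = sumn l + m &
      forall s, part l s <= part nu s /\ part nu s.+1 <= part l s].
Proof.
move=> Pl m0 lk [Cn CB mk [ch Hc]].
have k0 : 0 < k by lia.
have lk' : sumn l <= k by lia.
have Dn := strip_deg k0 Pl lk' Hc.
have nk : deg k nu <= k by lia.
have [_ dn] := strip_row0 k0 Pl lk' Cn mk Hc nk.
split; [by case/andP: Cn|lia|move=> s; split].
  exact: (strip_lower k0 Pl lk' Cn mk Hc).
exact: (strip_upper k0 Pl lk' Cn mk Hc).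
Qed.

(** The chain of shapes of a tableau of weight [mu]; interlacing of consecutive row lengths
    expresses that they differ by horizontal strips. *)
Definition tower (mu : seq nat) (A : seq (seq nat)) : Prop :=
  [/\ size A = (size mu).+1, nth [::] A 0 = [::],
      (forall i, i <= size mu -> is_partition (nth [::] A i)),
      (forall i, i < size mu -> sumn (nth [::] A i.+1) = sumn (nth [::] A i) + nth 0 mu i)
    & (forall i s, i < size mu ->
         part (nth [::] A i) s <= part (nth [::] A i.+1) s /\
         part (nth [::] A i.+1) s.+1 <= part (nth [::] A i) s)].

Lemma sumn_takeS (mu : seq nat) i : i < size mu -> sumn (take i.+1 mu) = sumn (take i mu) + nth 0 mu i.
Proof. by move=> im; rewrite (take_nth 0) // sumn_rcons. Qed.

Lemma sumn_take_le (mu : seq nat) i : sumn (take i mu) <= sumn mu.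
Proof. by rewrite -{2}(cat_take_drop i mu) sumn_cat leq_addr. Qed.

Lemma tower_sumn mu A i : tower mu A -> i <= size mu -> sumn (nth [::] A i) = sumn (take i mu).
Proof.
case=> _ A0 _ AS _; elim: i => [|i IH] im; first by rewrite A0 take0.
by rewrite AS // sumn_takeS // IH // ltnW.
Qed.

Lemma tower_sumn_last mu A : tower mu A -> sumn (last [::] A) = sumn mu.
Proof.
move=> tA; have [sA _ _ _ _] := tA.
by rewrite -nth_last sA (tower_sumn tA) // take_size.
Qed.

Lemma tower_last_partition mu A : tower mu A -> is_partition (last [::] A).
Proof. by move=> [sA _ PA _ _]; rewrite -nth_last sA; apply: PA. Qed.

(** By induction the [i]-th core is a partition of [mu_1 + ... + mu_i <= n], so the analysis of
    strips over small partitions applies at every level, and [kshape n] fixes the inner shape. *)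
Lemma ABC_set_tower n lam mu A : 0 < n -> partition_of n mu ->
  ABC_set n lam mu A <-> tower mu A /\ last [::] A = lam.
Proof.
move=> n0 /andP[Pmu /eqP Smu].
have mu_gt0 i : i < size mu -> 0 < nth 0 mu i by move=> im; rewrite -/(part mu i) part_gt0.
have bound i : i < size mu -> sumn (take i mu) + nth 0 mu i <= n.
  by move=> im; rewrite -sumn_takeS // -Smu sumn_take_le.
split.
  case=> [[_ sA A0 _ strips] _ Ek].
  have H i : i <= size mu -> is_partition (nth [::] A i) /\ sumn (nth [::] A i) = sumn (take i mu).
    elim: i => [|i IH] im; first by rewrite A0 take0.
    have [Pi Si] := IH (ltnW im); have b := bound i im.
    rewrite -Si in b; have := strips i.+1 im => /=.
    case/(bottom_strong_strip_small Pi (mu_gt0 _ im) b) => P' S' _.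
    by rewrite S' Si sumn_takeS.
  have tA : tower mu A.
    split=> //; first by move=> i /H[].
      by move=> i im; rewrite (H i (ltnW im)).2 (H _ im).2 sumn_takeS.
    move=> i s im; have [Pi Si] := H i (ltnW im); have b := bound i im.
    rewrite -Si in b; have := strips i.+1 im => /=.
    by case/(bottom_strong_strip_small Pi (mu_gt0 _ im) b).
  split=> //; move: Ek; rewrite kshape_small //; first exact: tower_last_partition tA.
  by rewrite (tower_sumn_last tA) Smu.
case=> tA Elam; have [sA A0 PA AS AI] := tA.
have small i : i <= size mu -> sumn (nth [::] A i) <= n.
  by move=> im; rewrite (tower_sumn tA im) -Smu sumn_take_le.
have lastC : is_core n (last [::] A).
  by apply: small_core; [exact: tower_last_partition tA|rewrite (tower_sumn_last tA) Smu].
split=> //; last first.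
  by rewrite kshape_small //; [exact: tower_last_partition tA|rewrite (tower_sumn_last tA) Smu].
split=> //.
- apply/(all_nthP 0) => i im; rewrite mu_gt0 //=.
  by apply: leq_trans (bound i im); apply: leq_addl.
- by rewrite sA => i im; apply: small_core; [apply: PA|apply: small].
case=> // i im /=; apply: bottom_strong_strip_exists.
- by rewrite mu_gt0 //=; apply: leq_trans (bound i im); apply: leq_addl.
- exact/PA/ltnW.
- exact: PA.
- exact: AS.
- exact: small.
- by move=> s; case: (AI i s im).
- by move=> s; case: (AI i s im).
Qed.

(** The index of the first shape containing the cell is its letter; it is positive because the shape
    of index [0] is empty. *)
Definition entry (A : seq (seq nat)) (s c : nat) : nat := find (fun nu => c < part nu s) A.

Definition tableau_of (A : seq (seq nat)) : seq (seq nat) :=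
  [seq [seq entry A s c | c <- iota 0 (part (last [::] A) s)] | s <- iota 0 (size (last [::] A))].

Lemma count_interval lo hi N : lo <= hi <= N ->
  count (fun c => (c < hi) && ~~ (c < lo)) (iota 0 N) = hi - lo.
Proof.
elim: N hi => [|N IH] hi H; first by have -> : hi = 0 by lia.
rewrite -addn1 iotaD count_cat /= add0n addn0.
case: (eqVneq hi N.+1) => [E|ne].
  rewrite E (@eq_in_count _ _ (fun c => (c < N) && ~~ (c < lo))).
    case: (leqP lo N) => loN; first by rewrite IH; lia.
    rewrite (@eq_in_count _ _ pred0) ?count_pred0; first lia.
    by move=> c; rewrite mem_iota /= => ?; lia.
  by move=> c; rewrite mem_iota /= => ?; lia.
by rewrite IH; lia.
Qed.

Lemma sumn_map_part l N : size l <= N -> sumn [seq part l s | s <- iota 0 N] = sumn l.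
Proof.
move=> lN; rewrite (sumn_part lN) sumnE big_map -[X in iota _ X]subn0 -/(index_iota 0 N) big_mkord.
by [].
Qed.

Lemma sumn_map_sub (F G : nat -> nat) s : {in s, forall x, G x <= F x} ->
  sumn [seq F x - G x | x <- s] + sumn [seq G x | x <- s] = sumn [seq F x | x <- s].
Proof.
elim: s => //= a s IH H; have := H a; rewrite inE eqxx => /(_ isT).
have : {in s, forall x, G x <= F x} by move=> x xs; apply: H; rewrite inE xs orbT.
by move/IH; lia.
Qed.

(** * From towers to tableaux *)

Section TowerTableau.
Variables (mu : seq nat) (A : seq (seq nat)).
Hypothesis tA : tower mu A.
Local Notation lam := (last [::] A).
Local Notation a_ i s := (part (nth [::] A i) s).

Lemma tower_size : size A = (size mu).+1. Proof. by case: tA. Qed.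

Lemma tower_mono i j s : i <= j -> j <= size mu -> a_ i s <= a_ j s.
Proof.
elim: j => [|j IH]; first by rewrite leqn0 => /eqP->.
rewrite leq_eqVlt => /orP[/eqP->//|ij] jm; apply: leq_trans (IH ij (ltnW jm)) _.
by case: tA => _ _ _ _ /(_ j s jm)[].
Qed.

Lemma tower_last s : a_ (size mu) s = part lam s.
Proof. by rewrite -nth_last tower_size. Qed.

Lemma entry_le i s c : i <= size mu -> (entry A s c <= i) = (c < a_ i s).
Proof.
move=> im; apply/idP/idP => [H|ci].
  have hasA : has (fun nu => c < part nu s) A.
    by rewrite has_find tower_size; move: H; rewrite /entry; lia.
  by apply: leq_trans (nth_find [::] hasA) _; apply: tower_mono.
rewrite leqNgt; apply/negP => /(before_find [::]).
by rewrite ci.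
Qed.

Lemma entry_bounds s c : c < part lam s -> 0 < entry A s c <= size mu.
Proof.
rewrite -tower_last -entry_le // => ->; rewrite andbT lt0n -leqn0 entry_le //.
by case: tA => _ -> _ _ _; rewrite /part nth_nil.
Qed.

Lemma entry_row s c c' : c <= c' -> c' < part lam s -> entry A s c <= entry A s c'.
Proof.
move=> cc' /entry_bounds/andP[_ em]; rewrite entry_le //; apply: leq_ltn_trans cc' _.
by rewrite -entry_le.
Qed.

Lemma entry_col s c : c < part lam s.+1 -> entry A s c < entry A s.+1 c.
Proof.
move=> /entry_bounds/andP[e0 em]; case E: (entry A s.+1 c) e0 em => [//|e] _ em.
rewrite ltnS entry_le; last exact: ltnW.
have : c < a_ e.+1 s.+1 by rewrite -entry_le // E.
by case: tA => _ _ _ _ /(_ e s em)[_ H] /leq_trans; apply.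
Qed.

Lemma lam_partition : is_partition lam. Proof. exact: tower_last_partition tA. Qed.

Lemma entry_mono s s' c c' : s <= s' -> c <= c' -> c' < part lam s' ->
  entry A s c + (s' - s) <= entry A s' c'.
Proof.
move=> ss cc cl; apply: (@leq_trans (entry A s c' + (s' - s))).
  rewrite leq_add2r; apply: entry_row => //; apply: leq_trans cl _.
  exact: part_le lam_partition ss.
elim: s' ss cl => [|s' IH]; first by case: (s) => // _ _; rewrite subn0 addn0.
rewrite leq_eqVlt => /orP[/eqP->|ss] cl; first by rewrite subnn addn0.
have := entry_col cl; have := IH ss (leq_trans cl (part_leS _ lam_partition)); lia.
Qed.

Lemma entry_eq s c i : 0 < i <= size mu -> (entry A s c == i) = (a_ i.-1 s <= c < a_ i s).
Proof.
case: i => // i /andP[_ im].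
by have := entry_le s c im; have := entry_le s c (ltnW im) => /=; lia.
Qed.

Lemma size_tableau_of : size (tableau_of A) = size lam.
Proof. by rewrite size_map size_iota. Qed.

Lemma nth_tableau_of s : s < size lam ->
  nth [::] (tableau_of A) s = [seq entry A s c | c <- iota 0 (part lam s)].
Proof. by move=> sl; rewrite (nth_map 0) ?size_iota // nth_iota. Qed.

Lemma size_nth_tableau_of s : size (nth [::] (tableau_of A) s) = part lam s.
Proof.
case: (ltnP s (size lam)) => sl; first by rewrite nth_tableau_of // size_map size_iota.
by rewrite /part !nth_default ?size_tableau_of.
Qed.

Lemma nth_nth_tableau_of s c : c < part lam s -> nth 0 (nth [::] (tableau_of A) s) c = entry A s c.
Proof.
move=> cl; have sl : s < size lam by rewrite -part_gt0 ?lam_partition //; lia.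
by rewrite nth_tableau_of // (nth_map 0) ?size_iota // nth_iota.
Qed.

Lemma size_tower_le i : i <= size mu -> size (nth [::] A i) <= size lam.
Proof.
move=> im; have Pi : is_partition (nth [::] A i) by case: tA => _ _ /(_ i im).
rewrite leqNgt; apply/negP => H.
have := part_gt0 (size lam) Pi; rewrite H => H'.
have := part_gt0 (size lam) lam_partition; rewrite ltnn -tower_last.
by have := tower_mono (size lam) im (leqnn _); lia.
Qed.

Lemma tableau_of_weight a : count_mem a.+1 (flatten (tableau_of A)) = nth 0 mu a.
Proof.
rewrite count_flatten -map_comp; case: (ltnP a (size mu)) => am; last first.
  rewrite [RHS]nth_default //; apply/eqP; rewrite sumnE big_map; apply/eqP/big1_seq => s _ /=.
  apply/count_memPn/mapP => [[c]]; rewrite mem_iota => cl E.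
  by have := @entry_bounds s c cl; lia.
have E s : (count_mem a.+1 \o (fun s => [seq entry A s c | c <- iota 0 (part lam s)])) s =
    a_ a.+1 s - a_ a s.
  rewrite /= count_map -(@count_interval (a_ a s) (a_ a.+1 s) (part lam s)).
    apply: eq_in_count => c _ /=; have := entry_le s c am; have := entry_le s c (ltnW am).
    by lia.
  by rewrite -tower_last !tower_mono.
rewrite (eq_map E); have := @sumn_map_sub (fun s => a_ a.+1 s) (fun s => a_ a s) (iota 0 (size lam)).
rewrite !sumn_map_part ?size_tower_le //; last exact: ltnW.
case: tA => _ _ _ /(_ a am)-> _ H.
have := H _; rewrite addnC => /(_ _)/addnI; apply.
by move=> s _; apply: tower_mono.
Qed.

Lemma tableau_of_SSYT : is_SSYT lam mu (tableau_of A).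
Proof.
split; first exact: size_tableau_of.
- by move=> i _; apply: size_nth_tableau_of.
- apply/allP => row /mapP[s _ ->]; apply/andP; split.
    apply/allP => x /mapP[c]; rewrite mem_iota => cl ->.
    by case/andP: (@entry_bounds s c cl).
  apply/(sortedP 0) => c; rewrite size_map size_iota => cl.
  rewrite !(nth_map 0) ?size_iota //; last exact: ltnW.
  by rewrite !nth_iota //; [apply: entry_row|exact: ltnW].
- move=> s c; rewrite size_nth_tableau_of => cl.
  rewrite !nth_nth_tableau_of //; first exact: entry_col.
  exact: leq_trans cl (part_leS _ lam_partition).
- exact: tableau_of_weight.
Qed.
End TowerTableau.

Lemma ltn_ext x y : (forall c, (c < x) = (c < y)) -> x = y.
Proof. by move=> H; have := H x; have := H y; lia. Qed.

Lemma tableau_of_inj mu A B : tower mu A -> tower mu B -> last [::] A = last [::] B ->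
  tableau_of A = tableau_of B -> A = B.
Proof.
move=> tA tB El Et; have sA := tower_size tA; have sB := tower_size tB.
apply: (@eq_from_nth _ [::]); first by rewrite sA sB.
rewrite sA => i im; have [_ _ PA _ _] := tA; have [_ _ PB _ _] := tB.
apply: part_eq; [exact: PA|exact: PB|move=> s].
apply: ltn_ext => c; case: (ltnP c (part (last [::] A) s)) => cl.
  rewrite -(entry_le tA) // -(entry_le tB) // -(nth_nth_tableau_of tA cl) Et.
  by rewrite (nth_nth_tableau_of tB) // -El.
have := tower_mono tA s (im : i <= _) (leqnn _); have := tower_mono tB s (im : i <= _) (leqnn _).
by rewrite (tower_last tA) (tower_last tB) -El; lia.
Qed.

Lemma sorted_geq_nth (l : seq nat) i j : sorted geq l -> i <= j -> nth 0 l j <= nth 0 l i.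
Proof.
move=> sl ij; case: (ltnP j (size l)) => jl; last by rewrite [X in X <= _]nth_default.
have tr : transitive geq by move=> y x z /= xy yz; apply: leq_trans yz xy.
by apply: (sorted_leq_nth tr (@leqnn) 0 sl) => //; rewrite inE //; apply: leq_ltn_trans jl.
Qed.

Lemma part_filter_gt0 (l : seq nat) s : sorted geq l -> part (filter (leq 1) l) s = nth 0 l s.
Proof.
rewrite /part; elim: l s => // a l IH s sl; have sl' := path_sorted sl.
rewrite /=; case: a sl => [|a] sl /=; last by case: s => //= s; rewrite IH.
have z j : nth 0 (0 :: l) j = 0.
  by apply/eqP; rewrite -leqn0; apply: (@sorted_geq_nth (0 :: l) 0 j).
by rewrite IH // z; apply: (z s.+1).
Qed.

Lemma is_partition_filter (l : seq nat) : sorted geq l -> is_partition (filter (leq 1) l).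
Proof.
move=> sl; rewrite /is_partition filter_all andbT; apply: sorted_filter => // y x z /= xy yz; exact: leq_trans yz xy.
Qed.

Lemma sumn_filter_gt0 (l : seq nat) : sumn (filter (leq 1) l) = sumn l.
Proof. by elim: l => //= [[|a]] l /= ->. Qed.

Lemma count_leq_sorted (row : seq nat) i c : sorted leq row ->
  (c < count (fun x => x <= i) row) = (c < size row) && (nth 0 row c <= i).
Proof.
elim: row c => [|x row IH] c //= sr; have {}IH := IH _ (path_sorted sr).
case: (leqP x i) => xi; first by case: c => [|c] //=; rewrite add1n !ltnS IH.
rewrite add0n (_ : count _ _ = 0); last first.
  apply/eqP; rewrite -leqn0 leqNgt -has_count; apply/hasPn => y yr.
  by rewrite -ltnNge; have := order_path_min leq_trans sr => /allP/(_ y yr); lia.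
apply/esym/negbTE/negP => /andP[cs]; case: c cs => [|c] cs /=; first lia.
have := order_path_min leq_trans sr => /allP/(_ (nth 0 row c)).
by rewrite mem_nth //; lia.
Qed.

(** * From tableaux to towers *)

Section TableauTower.
Variables (lam mu : seq nat) (T : seq (seq nat)).
Hypotheses (Plam : is_partition lam) (sT : is_SSYT lam mu T).

Let cT i s := count (fun x => x <= i) (nth [::] T s).

(** The [i]-th shape is occupied by the letters at most [i]. Its empty rows come last
    ([counts_sorted]), so discarding them keeps the row indices. *)
Definition tower_of : seq (seq nat) :=
  mkseq (fun i => filter (leq 1) [seq count (fun x => x <= i) row | row <- T]) (size mu).+1.

Lemma size_row s : size (nth [::] T s) = part lam s.
Proof.
case: sT => T1 T2 _ _ _; case: (ltnP s (size lam)) => sl; first exact: T2.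
by rewrite /part !nth_default ?T1.
Qed.

Lemma row_sorted s : sorted leq (nth [::] T s).
Proof.
case: sT => T1 _ /allP T3 _ _; case: (ltnP s (size T)) => sl; last by rewrite nth_default.
by case/andP: (T3 _ (mem_nth [::] sl)).
Qed.

Lemma ltn_row_count i s c : (c < cT i s) = (c < part lam s) && (nth 0 (nth [::] T s) c <= i).
Proof. by rewrite /cT count_leq_sorted ?row_sorted // size_row. Qed.

Lemma row_count_next i s c : c < cT i.+1 s.+1 -> c < cT i s.
Proof.
rewrite !ltn_row_count => /andP[cl H]; rewrite (leq_trans cl (part_leS _ Plam)) /=.
by case: sT => _ _ _ /(_ s c) + _; rewrite size_row => /(_ cl); lia.
Qed.

Lemma row_count_weak i s c : c < cT i s -> c < cT i.+1 s.
Proof. by rewrite !ltn_row_count => /andP[-> H]; apply: leqW. Qed.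

Lemma nth_counts i s : nth 0 [seq count (fun x => x <= i) row | row <- T] s = cT i s.
Proof.
rewrite /cT; case: (ltnP s (size T)) => sl; first by rewrite (nth_map [::]).
by rewrite !nth_default ?size_map.
Qed.

Lemma counts_sorted i : sorted geq [seq count (fun x => x <= i) row | row <- T].
Proof.
apply/(sortedP 0) => s _; rewrite !nth_counts /= leqNgt; apply/negP => H.
by have := row_count_next (row_count_weak H); rewrite ltnn.
Qed.

Lemma part_tower_of i s : i <= size mu -> part (nth [::] tower_of i) s = cT i s.
Proof. by move=> im; rewrite nth_mkseq // part_filter_gt0 ?counts_sorted // nth_counts. Qed.

Lemma cell_entry s c : c < part lam s ->
  nth 0 (nth [::] T s) c \in flatten T.
Proof.
move=> cl; have [T1 _ _ _ _] := sT; apply/flattenP; exists (nth [::] T s).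
  by apply: mem_nth; rewrite T1 -part_gt0 //; lia.
by apply: mem_nth; rewrite size_row.
Qed.

Lemma cell_bounds s c : c < part lam s -> 0 < nth 0 (nth [::] T s) c <= size mu.
Proof.
move=> cl; have := cell_entry cl; set x := nth 0 _ c => xT.
have [T1 _ /allP T3 _ T5] := sT.
have x0 : 0 < x.
  case/flattenP: xT => row /T3/andP[/allP H _]; exact: H.
rewrite x0 /=; case: x x0 xT => // x _ xT; rewrite ltnNge; apply/negP => mx.
by move: xT; rewrite -has_pred1 has_count T5 nth_default.
Qed.

Lemma tower_ofP : tower mu tower_of.
Proof.
have [T1 _ /allP T3 _ T5] := sT; split; first by rewrite size_mkseq.
- apply: part_eq => //; first by rewrite nth_mkseq // is_partition_filter ?counts_sorted.
  move=> s; rewrite part_tower_of // [RHS]/part nth_nil; apply/eqP; rewrite -leqn0 leqNgt.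
  by rewrite ltn_row_count; apply/negP => /andP[/cell_bounds]; lia.
- by move=> i im; rewrite nth_mkseq // is_partition_filter ?counts_sorted.
- move=> i im; rewrite !nth_mkseq //; last exact: leqW.
  rewrite !sumn_filter_gt0 -!count_flatten -T5.
  by elim: (flatten T) => //= x s ->; lia.
move=> i s im; rewrite !part_tower_of //; try exact: ltnW.
split; rewrite leqNgt; apply/negP.
  by move/row_count_weak; rewrite ltnn.
by move/row_count_next; rewrite ltnn.
Qed.

Lemma last_tower_of : last [::] tower_of = lam.
Proof.
apply: part_eq => //; first exact: tower_last_partition tower_ofP.
move=> s; rewrite -(tower_last tower_ofP) part_tower_of //; apply: ltn_ext => c.
by rewrite ltn_row_count; case: ltnP => // /cell_bounds/andP[_ ->].
Qed.

Lemma tableau_of_tower_of : tableau_of tower_of = T.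
Proof.
have [T1 _ _ _ _] := sT; have tA := tower_ofP.
apply: (@eq_from_nth _ [::]); first by rewrite size_tableau_of last_tower_of T1.
move=> s _; apply: (@eq_from_nth _ 0).
  by rewrite size_nth_tableau_of last_tower_of size_row.
rewrite size_nth_tableau_of => c cl; rewrite (nth_nth_tableau_of tA cl).
have := entry_bounds tA cl; rewrite last_tower_of in cl.
have := cell_bounds cl; set x := nth 0 _ c; set e := entry _ _ _ => xb eb.
have H i : i <= size mu -> (e <= i) = (x <= i).
  by move=> im; rewrite (entry_le tA) // part_tower_of // ltn_row_count cl.
by have := H e; have := H x; lia.
Qed.
End TableauTower.

(** * Comparison of the two charges *)

(** The residue is a cyclic distance measured leftward from [c - 1], so that [c] itself comes last,
    with residue [k]; [modv_right] is the case where the distance wraps around. *)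
Lemma modv_left k c x : x < c -> c <= x + k.+1 -> modv k c x = c - x - 1.
Proof.
move=> xc cx; rewrite /modv.
have -> : (c%:Z - x%:Z + k%:Z = (c - x - 1)%N%:Z + k.+1%:Z)%R by lia.
by rewrite modzDr modz_small //; lia.
Qed.

Lemma modv_right k c x : c <= x -> x <= c + k -> modv k c x = c + k - x.
Proof.
move=> xc cx; rewrite /modv.
have -> : (c%:Z - x%:Z + k%:Z = (c + k - x)%N%:Z)%R by lia.
by rewrite modz_small //; lia.
Qed.

Lemma minlP (t : seq nat) : t != [::] -> minl t \in t /\ forall y, y \in t -> minl t <= y.
Proof.
rewrite /minl; case: t => // a t _ /=.
have H : forall u, (foldr minn a u = a \/ foldr minn a u \in u) /\ foldr minn a u <= a /\
    forall y, y \in u -> foldr minn a u <= y.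
  elim=> [|b u [H1 [H2 H3]]] /=; first by split; [left|].
  split; [|split].
  - by rewrite /minn inE; case: ltnP => _; rewrite ?eqxx ?orbT; [right|case: H1 => [|->]; [left|right; rewrite orbT]].
  - by rewrite geq_min H2 orbT.
  - by move=> y; rewrite inE geq_min => /orP[/eqP->|/H3->]; rewrite ?leqnn ?orbT.
have [H1 [H2 H3]] := H t; split.
  rewrite inE /minn; case: ltnP => h; first by rewrite eqxx.
  by case: H1 => ->; rewrite ?eqxx ?orbT.
by move=> y; rewrite inE geq_min => /orP[/eqP->|/H3->]; rewrite ?leqnn ?orbT.
Qed.

Section Columns.
Variable k : nat.
Definition col (x : cell) : nat := k + 2 + x.2 - x.1.

(** Rows at most [k] make the subtraction in [col] exact. Columns at most [k] apart are distinct
    modulo [k + 1], and every column left of the start has a smaller residue than every wrapped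
    one. *)
Definition in_window (P : pred cell) := forall x y, P x -> P y ->
  [/\ x.1 <= k, y.1 <= k & col x <= col y + k].

Lemma clt_col x y : x.1 <= k -> y.1 <= k -> clt x y = (col x < col y).
Proof. by rewrite /clt /col => *; lia. Qed.

(** Residues decrease as columns grow, both left of [p] and among the wrapped columns, and the pick
    is the largest column of the group it comes from. The second conclusion makes the minimum
    unique. *)
Lemma scan_left_modv (P : pred cell) p s v (q := scan_left clt p s) : in_window P ->
  pairwise rlt s -> {in s &, forall x y, rlt x y -> clt x y} ->
  P p -> {subset s <= P} -> v \in s ->
  modv k (col p) (col q) <= modv k (col p) (col v) /\
  (modv k (col p) (col q) = modv k (col p) (col v) -> col v = col q).
Proof.
move=> W Ps rc Pp sP vs.
have qs : q \in s by apply: scan_left_mem; case: (s) vs.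
have [q1 p1 wqp] := W q p (sP _ qs) Pp; have [_ _ wpq] := W p q Pp (sP _ qs).
have [v1 _ wvp] := W v p (sP _ vs) Pp; have [_ _ wpv] := W p v Pp (sP _ vs).
have [_ _ wvq] := W v q (sP _ vs) (sP _ qs).
have vmax : (clt q p -> clt v p) -> col v <= col q.
  move=> H; case: (scan_left_max Ps vs H) => [->//|vq].
  by have := rc v q vs qs vq; rewrite clt_col //; apply: ltnW.
have vcut : clt v p -> clt q p by apply: scan_left_cut.
rewrite !clt_col // in vmax vcut.
case: (ltnP (col q) (col p)) vmax vcut => qp vmax vcut; last first.
  have := vmax (fun H => False_ind _ _); rewrite !modv_right; lia.
rewrite (modv_left qp); last lia.
case: (ltnP (col v) (col p)) vmax {vcut} => vp vmax.
  by rewrite (modv_left vp); [have := vmax (fun _ => isT)|]; lia.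
by rewrite (modv_right vp); lia.
Qed.

(** Entries are compared as sets because nothing excludes repetitions in the list that [build_row]
    filters; they are empty once the matched cells run out. *)
Definition represents (E : seq (seq nat)) (C : seq cell) :=
  forall r, nth [::] E r =i (if r < size C then [:: col (nth x0 C r)] else [::]).

Lemma mem0_nil (T : eqType) (s : seq T) : s =i [::] -> s = [::].
Proof. by case: s => // a s /(_ a); rewrite inE eqxx. Qed.

Lemma build_row_represents (P : pred cell) V prev used ps s : in_window P ->
  pairwise rlt s -> {in s &, forall x y, rlt x y -> clt x y} ->
  {subset ps <= P} -> {subset s <= P} ->
  (forall x, (x \in V) && (x \notin used) = (x \in map col s)) ->
  represents prev ps -> represents (build_row k V prev used) (greedy_match clt ps s).
Proof.
move=> W; elim: prev used ps s => [|pr prev IH] used ps s Ps rc psP sP HV Hr.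
  have -> : ps = [::].
    case: ps psP Hr => // p ps _ /(_ 0) /= /(_ (col p)).
    by rewrite inE eqxx.
  by move=> r; rewrite nth_nil.
have avE : [seq x <- V | x \notin used] =i map col s.
  by move=> x; rewrite mem_filter andbC HV.
rewrite [build_row _ _ _ _]/=; set avail := [seq x <- V | x \notin used] in avE *.
set e := filter _ avail.
have nil_case : e = [::] -> represents (build_row k V prev (used ++ e)) [::] ->
    represents (e :: build_row k V prev (used ++ e)) [::].
  by move=> -> H [|r] //=; apply: H.
case: ps psP Hr => [|p ps] psP Hr.
  have pr0 : pr = [::] by apply: mem0_nil => x; apply: (Hr 0).
  have e0 : e = [::] by rewrite /e pr0 /= filter_pred0.
  apply: nil_case => //; rewrite e0 cats0.
  by apply: (IH _ [::] s) => //; move=> r; apply: (Hr r.+1).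
have Hr' : represents prev ps by move=> r; apply: (Hr r.+1).
have psP' : {subset ps <= P} by move=> x xp; apply: psP; rewrite inE xp orbT.
case: (eqVneq s [::]) => [s0|sn0].
  have av0 : avail = [::] by apply: mem0_nil => x; rewrite avE s0.
  have e0 : e = [::] by rewrite /e av0.
  rewrite s0; apply: nil_case => //; rewrite e0 cats0 -(greedy_match_nil clt ps) -s0.
  exact: IH.
rewrite greedy_match_cons //; set q := scan_left clt p s.
have Pp : P p by apply: psP; rewrite inE eqxx.
have qs : q \in s by apply: scan_left_mem.
have us := pairwise_rlt_uniq Ps.
have colinj : {in s &, injective col}.
  move=> x y xs ys E; have [x1 y1 _] := W x y (sP _ xs) (sP _ ys).
  have [//|ne] := eqVneq x y.
  have : rlt x y || rlt y x.
    by move: x y ne {xs ys E x1 y1} => [a b] [c d]; rewrite /rlt xpair_eqE /=; lia.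
  by case/orP=> /rc; [move=> /(_ xs ys)|move=> /(_ ys xs)]; rewrite clt_col // E ltnn.
have av0 : [seq modv k (col p) y | y <- avail] != [::].
  have : col q \in avail by rewrite avE map_f.
  by case: (avail).
have [mm ml] := minlP av0.
have minE : minl [seq modv k (col p) y | y <- avail] = modv k (col p) (col q).
  apply/eqP; rewrite eqn_leq ml; last by apply: map_f; rewrite avE map_f.
  case/mapP: mm => y; rewrite avE => /mapP[v vs ->] ->.
  by have [-> _] := scan_left_modv W Ps rc Pp sP vs.
have eE : e =i [:: col q].
  move=> x; rewrite mem_filter avE inE.
  have -> : has (fun c => modv k c x == minl [seq modv k c y | y <- avail]) pr =
     (modv k (col p) x == modv k (col p) (col q)).
    have /eq_has_r-> : pr =i [:: col p] := Hr 0.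
    by rewrite /= orbF minE.
  apply/andP/eqP => [[/eqP E /mapP[v vs Ev]]|->]; last by rewrite eqxx map_f.
  rewrite Ev in E *; have [_ H] := scan_left_modv W Ps rc Pp sP vs.
  exact: H.
have IHr := IH (used ++ e) ps (rem q s).
move=> [|r]; first exact: eE.
apply: IHr => //.
- exact: pairwise_rlt_rem.
- by move=> x y /mem_rem xs /mem_rem ys; apply: rc.
- by move=> x /mem_rem; apply: sP.
move=> x; rewrite mem_cat negb_or andbA HV eE inE.
apply/andP/mapP => [[/mapP[v vs ->] ne]|[v]].
  by exists v => //; rewrite mem_rem_uniq // inE vs andbT; apply: contraNneq ne => ->.
rewrite mem_rem_uniq // inE => /andP[vq vs] ->; split; first exact: map_f.
by apply: contraNneq vq => /colinj ->.
Qed.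
End Columns.

(** Every scan for the letter 1 starts afresh from the right end, so each takes the rightmost
    remaining cell. *)
Lemma greedy_match_nseq_rev p0 s : uniq s -> (forall x, x \in s -> rlt x p0) ->
  greedy_match rlt (nseq (size s) p0) s = rev s.
Proof.
elim/last_ind: s => // s z IH; rewrite rcons_uniq => /andP[zs us] H.
rewrite size_rcons rev_rcons -[nseq _ _]/(p0 :: nseq (size s) p0) greedy_match_cons; last by case: (s).
have -> : scan_left rlt p0 (rcons s z) = z.
  rewrite /scan_left (_ : filter _ _ = rcons s z); first by case: (s) => //= *; rewrite last_rcons.
  by apply/all_filterP/allP.
have -> : rem z (rcons s z) = s.
  rewrite rem_filter ?rcons_uniq ?zs // filter_rcons /= eqxx /=.
  by apply/all_filterP/allP => x xs /=; apply: contraNneq zs => <-.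
by rewrite IH // => x xs; apply: H; rewrite mem_rcons inE xs orbT.
Qed.

Lemma filter_take_find (P : pred nat) b n : (forall a, b <= a -> P a.+1 -> P a) ->
  [seq a <- iota b n | P a] = take (find (fun a => ~~ P a) (iota b n)) (iota b n).
Proof.
elim: n b => // n IH b H /=; case Pb: (P b) => /=.
  by congr cons; apply: IH => a ba; apply: H; apply: ltnW.
apply/eqP; rewrite -[_ == _]negbK -has_filter; apply/hasPn => a; rewrite mem_iota => /andP[ba _].
have nP d : ~~ P (b + d).
  elim: d => [|d IHd]; first by rewrite addn0 Pb.
  by rewrite addnS; apply: contra IHd; apply: H; apply: leq_addr.
by rewrite -(subnKC (ltnW ba)); apply: nP.
Qed.

Definition reading_cells (lam : seq nat) N : seq cell :=
  flatten [seq [seq (s, c) | c <- iota 0 (part lam s)] | s <- rev (iota 0 N)].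

Lemma reading_cellsS lam N : reading_cells lam N.+1 =
  [seq (N, c) | c <- iota 0 (part lam N)] ++ reading_cells lam N.
Proof. by rewrite /reading_cells -[in LHS](addn1 N) iotaD cats1 rev_rcons. Qed.

Lemma mem_reading_cells lam N s c : ((s, c) \in reading_cells lam N) = (s < N) && (c < part lam s).
Proof.
elim: N => // N IH; rewrite reading_cellsS mem_cat IH.
apply/orP/idP => [[/mapP[c']|]|].
- by rewrite mem_iota => cl [-> ->]; lia.
- by lia.
rewrite ltnS leq_eqVlt => /andP[/orP[/eqP->|->] cl]; last by right.
by left; apply/mapP; exists c => //; rewrite mem_iota.
Qed.

Lemma reading_cells_pairwise lam N : pairwise rlt (reading_cells lam N).
Proof.
elim: N => // N IH; rewrite reading_cellsS pairwise_cat IH andbT; apply/andP; split.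
  apply/allrelP => x [s c] /mapP[c' _ ->]; rewrite mem_reading_cells => /andP[sN _].
  by rewrite /rlt /= sN.
rewrite pairwise_map; apply: (@sub_pairwise _ ltn).
  by move=> a b ab; rewrite /= /rlt /= ltnn eqxx.
by rewrite -(sorted_pairwise ltn_trans) iota_ltn_sorted.
Qed.

(** * Matched cells of a tower and the sets they represent *)

Section Charge.
Variables (k : nat) (mu : seq nat) (A : seq (seq nat)).
Hypotheses (Pmu : is_partition mu) (kmu : sumn mu <= k) (tA : tower mu A).
Hypothesis strips : forall i, 0 < i <= size mu ->
  bottom_strong_strip k (nth [::] A i) (Defs.bump k (nth [::] A i.-1)) (k - nth 0 mu i.-1).
Local Notation lam := (last [::] A).

Definition cell_letter (x : cell) := entry A x.1 x.2.
Definition tableau_cells := reading_cells lam (size lam).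
(** Row [0] is read last and [tableau_cells_bounds] keeps columns below [k], so this point comes
    after every cell. *)
Definition scan_start : cell := (0, k.+1).
Definition letter_cells := layer cell_letter tableau_cells.
Definition matched_cells := layer_match rlt scan_start letter_cells.
Local Notation ell := cell_letter.
Local Notation R := tableau_cells.
Local Notation p0 := scan_start.
Local Notation L := letter_cells.
Local Notation M := matched_cells.

Lemma mem_tableau_cells s c : ((s, c) \in R) = (c < part lam s).
Proof.
by rewrite mem_reading_cells -part_gt0 ?(lam_partition tA) //; case: (part lam s).
Qed.

Lemma tableau_cells_pairwise : pairwise rlt R. Proof. exact: reading_cells_pairwise. Qed.

Lemma sumn_inner_le : sumn lam <= k. Proof. by rewrite (tower_sumn_last tA). Qed.

Lemma tableau_cells_bounds x : x \in R -> part lam 0 + x.1 <= k /\ x.2 < part lam 0.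
Proof.
case: x => s c; rewrite mem_tableau_cells => cl; have Pl := lam_partition tA.
rewrite [(s, c).1]/= [(s, c).2]/=; have := part_hook_le Pl (leq_ltn_trans (leq0n _) cl); have := part_le Pl (leq0n s).
by have := sumn_inner_le; lia.
Qed.

(** Contents range from minus the row index to [lam_0 - 1], and [lam_0] plus the index of any
    nonempty row is at most [k]. *)
Lemma tableau_cells_window : in_window k (mem R).
Proof.
move=> [s c] [s' c'] /tableau_cells_bounds + /tableau_cells_bounds; rewrite /col.
by move: (part lam 0) => l0 /= [x1 x2] [y1 y2]; split; lia.
Qed.

Lemma tableau_cells_lt_start x : x \in R -> rlt x p0.
Proof. by move/tableau_cells_bounds; move: (part lam 0) => l0; case: x => [[|s] c]; rewrite /rlt /=; lia. Qed.

Lemma tableau_word_cells : tableau_word (tableau_of A) = map ell R.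
Proof. by rewrite /tableau_word /R /reading_cells map_flatten -map_rev -!map_comp; congr flatten; apply: eq_map => s /=; rewrite -map_comp. Qed.

Lemma size_letter_cells a : size (L a.+1) = nth 0 mu a.
Proof.
rewrite /L /layer size_filter -(tableau_of_weight tA a) -[LHS](count_map ell (pred1 a.+1)).
by rewrite -tableau_word_cells /tableau_word !count_flatten map_rev sumn_rev.
Qed.

Lemma size_letter_cells_dec a : 0 < a -> size (L a.+1) <= size (L a).
Proof. by case: a => // a _; rewrite !size_letter_cells; apply: part_leS. Qed.

Lemma cell_letter_bounds x : x \in R -> 0 < ell x <= size mu.
Proof. by case: x => s c; rewrite mem_tableau_cells; apply: (entry_bounds tA). Qed.

Lemma mem_letter_cells x a : (x \in L a) = (ell x == a) && (x \in R).
Proof. by rewrite mem_filter. Qed.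

Lemma letter_cells_pairwise a : pairwise rlt (L a). Proof. exact: pairwise_rlt_filter tableau_cells_pairwise. Qed.

Lemma cell_letter_mono (x y : cell) : x.1 <= y.1 -> x.2 <= y.2 -> y \in R ->
  ell x + (y.1 - x.1) <= ell y.
Proof. by case: y => s c; rewrite mem_tableau_cells => h1 h2 h3; apply: (entry_mono tA). Qed.

(** The cells of one letter form a horizontal strip: going down in rows means going strictly right
    in columns. *)
Lemma letter_cells_rlt_clt a : {in L a &, forall x y, rlt x y -> clt x y}.
Proof.
move=> x y; rewrite !mem_letter_cells => /andP[/eqP ex xR] /andP[/eqP ey yR].
have := @cell_letter_mono y x; rewrite ex ey xR => /(_ _ _ isT).
by move: x y {ex ey xR yR} => [s c] [s' c']; rewrite /rlt /clt /=; lia.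
Qed.

Lemma letter_cells_right a (u v : cell) : u \in L a -> v \in L a.+1 -> v.1 <= u.1 -> u.2 < v.2.
Proof.
rewrite !mem_letter_cells => /andP[/eqP eu uR] /andP[/eqP ev vR] vu.
rewrite ltnNge; apply/negP => uv; have := cell_letter_mono vu uv uR; lia.
Qed.

(** The corner cell [(u.1, v.2)] has letter at least [a], and its letter plus the number of rows up
    to [v] is at most [a + 1]. This leaves room for a single row and forces the letter [a]. *)
Lemma letter_cells_blocked a (u v : cell) : u \in L a -> v \in L a.+1 -> u.1 < v.1 -> u.2 < v.2 ->
  v.1 = u.1.+1 /\ (u.1, v.2) \in L a.
Proof.
rewrite !mem_letter_cells => /andP[/eqP eu uR] /andP[/eqP ev vR] uv uv2.
have wR : (u.1, v.2) \in R.
  rewrite mem_tableau_cells; apply: leq_trans (part_le (lam_partition tA) (ltnW uv)).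
  by move: vR; case: (v) => s c; rewrite mem_tableau_cells.
have h1 := cell_letter_mono (ltnW uv) (ltnW uv2) vR.
have h2 := @cell_letter_mono u (u.1, v.2) (leqnn _) (ltnW uv2) wR.
have h3 := @cell_letter_mono (u.1, v.2) v (ltnW uv) (leqnn _) vR.
rewrite [(u.1, v.2).1]/= in h2 h3.
by split; [lia|apply/andP; split=> //; apply/eqP; lia].
Qed.

Lemma matched_cells_perm a : 0 < a -> perm_eq (M a) (L a).
Proof.
case: a => // a _; rewrite /M /=; apply: greedy_match_perm.
elim: a => [|a IH]; first by rewrite size_nseq.
rewrite /= size_greedy_match (minn_idPr IH); exact: size_letter_cells_dec.
Qed.

Lemma matched_cells_row_order a (u w : cell) : 0 < a -> u \in L a -> w \in L a -> u.1 = w.1 -> u.2 < w.2 ->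
  index w (M a) < index u (M a).
Proof.
move=> a0 uL wL uw1 uw2; have uM : u \in M a by rewrite (perm_mem (matched_cells_perm a0)).
case: a a0 uL wL uM => // a _ uL wL uM.
apply: greedy_match_row_order => //; first exact: letter_cells_pairwise; last by rewrite /rlt uw1 eqxx uw2 orbT.
move=> p pM _ _; case: a uL wL uM pM => [|a] uL wL uM pM up.
  move: pM; rewrite mem_nseq => /andP[_ /eqP->].
  by apply: tableau_cells_lt_start; move: wL; rewrite mem_letter_cells => /andP[].
have pL : p \in L a.+1 by rewrite -(perm_mem (matched_cells_perm (ltn0Sn a))).
(* A cell [p] of the preceding letter in the row of [u] or higher lies in a smaller column, so [u]
   precedes [p] in the word only if [p] is in a lower row; then [w] precedes [p] too. *)
have := letter_cells_right pL uL; move: up; rewrite /rlt -uw1; lia.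
Qed.

(** Moving a blocked cell down into the row of [u] is injective and gives a cell of letter [a] right
    of [u], by [letter_cells_blocked]; [matched_cells_row_order] puts it before [u] in [M a]. *)
Lemma matched_cells_blocked a i : 0 < a -> i < size (M a) ->
  count (blocked (nth x0 (M a) i)) (L a.+1) <= count (right_of (nth x0 (M a) i)) (take i (M a)).
Proof.
move=> a0 iM; set u := nth x0 (M a) i.
have pM := matched_cells_perm a0; have uMa : uniq (M a).
  by rewrite (perm_uniq pM); apply/pairwise_rlt_uniq/letter_cells_pairwise.
have uM : u \in M a by apply: mem_nth.
have uL : u \in L a by rewrite -(perm_mem pM).
rewrite -!size_filter -(size_map (fun v : cell => (u.1, v.2))).
apply: uniq_leq_size.
  rewrite map_inj_in_uniq; first by apply/filter_uniq/pairwise_rlt_uniq/letter_cells_pairwise.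
  move=> [s c] [s' c']; rewrite !mem_filter /blocked /= => /andP[/andP[/eqP-> _] _] /andP[/andP[/eqP-> _] _].
  by case=> ->.
move=> w /mapP[v]; rewrite mem_filter => /andP[/andP[/eqP v1 v2] vL] ->.
have [|_ wL] := letter_cells_blocked uL vL _ v2; first by rewrite v1.
rewrite mem_filter /right_of /= eqxx v2 /= in_take ?(perm_mem pM) //.
rewrite -[i](index_uniq x0 iM uMa) -/u.
exact: matched_cells_row_order.
Qed.

Lemma matched_cells_step a : 0 < a ->
  M a.+1 = greedy_match clt (M a) (L a.+1) /\
  (forall r, r < size (M a.+1) ->
     rlt (nth x0 (M a) r) (nth x0 (M a.+1) r) = clt (nth x0 (M a) r) (nth x0 (M a.+1) r)).
Proof.
move=> a0; have mM x : (x \in M a) = (x \in L a) := perm_mem (matched_cells_perm a0) x.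
apply: greedy_match_rlt_clt; first exact: letter_cells_pairwise.
- by move=> u v; rewrite mM; apply: letter_cells_right.
- by move=> u v; rewrite mM => uL vL h1 h2; case: (letter_cells_blocked uL vL h1 h2).
- by move=> i; apply: matched_cells_blocked.
Qed.

Lemma mem_Vrow_letter_cells a x : 0 < a < size mu ->
  (x \in Vrow k mu A a.+1) = (x \in map (col k) (L a.+1)).
Proof.
case/andP=> a0 am; have [_ _ PA AS _] := tA.
have Sa := tower_sumn tA (ltnW am).
have mu0 i : i < size mu -> 0 < nth 0 mu i by rewrite -part_gt0.
have := sumn_takeS am => St.
have := sumn_take_le mu a.+1 => le.
have a0' : 0 < sumn (nth [::] A a).
  rewrite Sa; case: (a) a0 am => // b _ bm; rewrite sumn_takeS; last exact: ltnW.
  by have := mu0 b (ltnW bm); lia.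
have Vp := @mem_Vrow k mu A a.+1 x (PA a (ltnW am)) a0' (mu0 a am).
have lk : sumn (nth [::] A a) + nth 0 mu a <= k by lia.
have {}Vp := Vp lk (strips (i := a.+1) am).
have inR s c : c < part (nth [::] A a.+1) s -> (s, c) \in R.
  by rewrite mem_tableau_cells -(tower_last tA) => cl; apply: leq_trans cl (tower_mono tA _ am (leqnn _)).
have eE s c : (entry A s c == a.+1) = (part (nth [::] A a) s <= c < part (nth [::] A a.+1) s).
  by rewrite (entry_eq tA).
apply/idP/mapP => [/(proj1 Vp)[s [c [H1 H2]]]|[[s c]]].
  have scR : (s, c) \in R by apply: inR; case/andP: H1.
  exists (s, c); first by rewrite mem_letter_cells scR /ell eE H1.
  by have [] := tableau_cells_bounds scR; rewrite /col [(s, c).1]/= [(s, c).2]/=; lia.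
rewrite mem_letter_cells /ell eE => /andP[H1 scR] Ex; apply/(proj2 Vp); exists s, c; split=> //.
by have [] := tableau_cells_bounds scR; rewrite Ex /col [(s, c).1]/= [(s, c).2]/=; lia.
Qed.

Lemma letter_cells1 : 0 < size mu -> L 1 = [seq (0, c) | c <- iota 0 (nth 0 mu 0)].
Proof.
move=> m0; have [_ A0 PA AS AI] := tA.
have A1 s : part (nth [::] A 1) s.+1 = 0.
  by have [_] := AI 0 s m0; rewrite A0 [X in _ <= X]/part nth_nil leqn0 => /eqP.
have A10 : part (nth [::] A 1) 0 = nth 0 mu 0.
  have := AS 0 m0; rewrite A0 /= add0n => <-.
  have := PA 1 m0; move: (A1 0); case: (nth [::] A 1) => [|a [|b t]] //=; first by rewrite addn0.
  by rewrite /part /= => ->; rewrite !is_partition_cons ltnn !andbF.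
apply: (irr_sorted_eq rlt_trans rlt_irr).
- by rewrite (sorted_pairwise rlt_trans) letter_cells_pairwise.
- rewrite (sorted_pairwise rlt_trans) pairwise_map; apply: (@sub_pairwise _ ltn).
    by [].
  by rewrite -(sorted_pairwise ltn_trans) iota_ltn_sorted.
case=> s c; rewrite mem_letter_cells mem_tableau_cells /ell (entry_eq tA) //= A0 {1}/part nth_nil leq0n /=.
have mono := tower_mono tA s m0 (leqnn _); rewrite (tower_last tA) in mono.
apply/andP/mapP => [[]|[c']].
  case: s mono => [|s] mono; last by rewrite A1.
  by rewrite A10 => cm _; exists c => //; rewrite mem_iota.
rewrite mem_iota => cm [Es Ec]; move: mono; rewrite Es Ec A10 => mono.
by split=> //; apply: leq_trans mono.
Qed.

Lemma matched_cells1 : 0 < size mu -> M 1 = rev (L 1).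
Proof.
move=> m0; rewrite /M /=; apply: greedy_match_nseq_rev; first exact/pairwise_rlt_uniq/letter_cells_pairwise.
by move=> x; rewrite mem_letter_cells => /andP[_ /tableau_cells_lt_start].
Qed.

Lemma Erow_represents i : i < size mu -> represents k (Erow k mu A i.+1) (M i.+1).
Proof.
elim: i => [|i IH] im.
  (* The letters 1 fill columns [0] to [mu1 - 1] of row [0] and are taken from the right, so the one
     at position [r] has content [mu1 - r - 1] and column [k + mu1 + 2 - r.+1], the prescribed start
     of the set numbered [r.+1]. *)
  rewrite matched_cells1 // => r; rewrite size_rev letter_cells1 // size_map size_iota.
  case: ltnP => rm; last by rewrite nth_default // size_map size_iota.
  rewrite (nth_map 0) ?size_iota // nth_iota // nth_rev size_map size_iota //.
  rewrite (nth_map 0) ?size_iota; last lia.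
  rewrite nth_iota; last lia.
  by move=> x; rewrite !inE; congr (x == _); rewrite /col /mu1 /=; lia.
have [E _] := matched_cells_step (ltn0Sn i); rewrite E.
apply: (build_row_represents tableau_cells_window).
- exact: letter_cells_pairwise.
- exact: letter_cells_rlt_clt.
- by move=> x; rewrite (perm_mem (matched_cells_perm (ltn0Sn i))) mem_letter_cells => /andP[].
- by move=> x; rewrite mem_letter_cells => /andP[].
- by move=> x; rewrite andbT mem_Vrow_letter_cells.
- exact/IH/ltnW.
Qed.

Lemma size_matched_cells a : size (M a.+1) = nth 0 mu a.
Proof. by rewrite (perm_size (matched_cells_perm (ltn0Sn a))) size_letter_cells. Qed.

Definition round_length r := find (fun a => ~~ (r < size (M a))) (iota 1 (size mu)).

(** The sizes of the layers are the parts of [mu], so the letters still present in round [r] form an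
    initial segment. *)
Lemma roundE r : [seq a <- iota 1 (size mu) | r < size (M a)] = iota 1 (round_length r).
Proof.
rewrite filter_take_find ?take_iota.
  by congr iota; apply/minn_idPl; rewrite -[X in _ <= X](size_iota 1) find_size.
case=> // a _; rewrite !size_matched_cells => h; apply: leq_trans h _; exact: part_leS.
Qed.

Lemma Ecols_round r : Ecols k mu A r.+1 = map (col k) (round M (size mu) r).
Proof.
have H a : a \in iota 1 (size mu) ->
   nth [::] (Erow k mu A a) r =i (if r < size (M a) then [:: col k (nth x0 (M a) r)] else [::]).
  by case: a => [|a]; rewrite mem_iota // => am; apply: Erow_represents; lia.
rewrite /Ecols [r.+1.-1]/=.
have -> : find (fun i => nth [::] (Erow k mu A i) r == [::]) (iota 1 (size mu)) = round_length r.
  apply: eq_in_find => a /H Ha; apply/eqP/negP => [E|nr].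
    by move=> rM; have := Ha (col k (nth x0 (M a) r)); rewrite E rM inE eqxx.
  by apply: mem0_nil => x; rewrite Ha; case: ltnP nr.
rewrite take_iota (minn_idPl _); last by rewrite -[X in _ <= X](size_iota 1) find_size.
rewrite /round roundE -map_comp; apply/eq_in_map => a aI.
have : a \in [seq a <- iota 1 (size mu) | r < size (M a)] by rewrite roundE.
rewrite mem_filter => /andP[rM /H]; rewrite rM => E /=.
case Ee: (nth [::] (Erow k mu A a) r) E => [|y t] E.
  by have := E (col k (nth x0 (M a) r)); rewrite !inE eqxx.
by have := E y; rewrite !inE eqxx => /esym/eqP.
Qed.

(** Comparing columns is comparing contents, and on consecutive cells of a round this agrees with
    reading order by the second half of [matched_cells_step]. *)
Lemma round_charge r :
  rel_charge 0 ltn (map (col k) (round M (size mu) r)) = rel_charge x0 rlt (round M (size mu) r).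
Proof.
rewrite /rel_charge size_map; congr sumn; apply/eq_in_map => i; rewrite mem_iota => Hi.
congr sumn; apply/eq_in_map => t; rewrite mem_iota => Ht; congr nat_of_bool.
move: Hi; rewrite /round roundE !size_map size_iota => Hi.
have nthE b : 0 < b <= round_length r ->
   nth x0 [seq nth x0 (M a) r | a <- iota 1 (round_length r)] b.-1 = nth x0 (M b) r /\ r < size (M b).
  move=> Hb; have bI : b \in iota 1 (round_length r) by rewrite mem_iota; lia.
  rewrite (nth_map 0) ?size_iota; last lia.
  rewrite nth_iota; last lia.
  have -> : 1 + b.-1 = b by lia.
  by split=> //; move: bI; rewrite -roundE mem_filter => /andP[].
case: t Ht => [|[|t]] Ht; try lia.
rewrite !(nth_map x0) ?size_map ?size_iota; try by rewrite /=; lia.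
have [|E1 r1] := nthE t.+1; first lia.
have [|E2 r2] := nthE t.+2; first lia.
rewrite [t.+2.-2]/= [t.+2.-1]/= E1 E2.
have inR a : 0 < a -> r < size (M a) -> nth x0 (M a) r \in R.
  move=> a0 ra; have := mem_nth x0 ra; rewrite (perm_mem (matched_cells_perm a0)) mem_letter_cells.
  by case/andP.
rewrite (proj2 (matched_cells_step (ltn0Sn t))) //.
have [u1 v1 _] := tableau_cells_window (inR _ (ltn0Sn t) r1) (inR _ (ltn0Sn _) r2).
by rewrite (clt_col u1 v1).
Qed.

Lemma ABC_charge_tableau : ABC_charge k mu A = tableau_charge (tableau_of A).
Proof.
rewrite /tableau_charge /word_charge tableau_word_cells size_map.
rewrite (@word_charge_rounds ell p0 (size mu)) //.
- rewrite -/L -/M size_letter_cells /ABC_charge /mu1 -[X in iota X _]/(1 + 0) iotaDl -map_comp.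
  congr sumn; apply: eq_map => r /=.
  by rewrite add1n Ecols_round perm_charge_reading round_charge.
- exact: tableau_cells_pairwise.
- exact: cell_letter_bounds.
- exact: tableau_cells_lt_start.
- exact: size_letter_cells_dec.
Qed.
End Charge.

Theorem mainTheorem1 (n : nat) (lam mu : seq nat) :
  0 < n -> partition_of n lam -> partition_of n mu ->
  exists f : seq (seq nat) -> seq (seq nat),
    [/\ (forall A, ABC_set n lam mu A -> is_SSYT lam mu (f A)),
        (forall A B, ABC_set n lam mu A -> ABC_set n lam mu B -> f A = f B -> A = B),
        (forall T, is_SSYT lam mu T -> exists2 A, ABC_set n lam mu A & f A = T) &
        (forall A, ABC_set n lam mu A -> ABC_charge n mu A = tableau_charge (f A))].
Proof.
move=> n0 /andP[Plam _] Pmu; exists tableau_of.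
have AT A := @ABC_set_tower n lam mu A n0 Pmu; have /andP[Pm /eqP Sm] := Pmu.
split.
- by move=> A /AT[tA <-]; apply: tableau_of_SSYT.
- by move=> A B /AT[tA EA] /AT[tB EB]; apply: (tableau_of_inj tA tB); rewrite EA EB.
- move=> T sT; exists (tower_of mu T); last exact: tableau_of_tower_of sT.
  by apply/AT; split; [apply: tower_ofP sT|apply: last_tower_of sT].
move=> A AA; have [tA _] := proj1 (AT A) AA.
case: AA => [[_ _ _ _ strips] _ _].
by apply: ABC_charge_tableau => //; rewrite Sm.
Qed.
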